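(* Let $(\Omega,\mathcal{C},\Lambda)$ be a naive convex co-compact triple and let $A\le\Lambda$ be an Abelian subgroup. Then $$\mathrm{Min}_{\mathcal{C}}(A):=\mathcal{C}\cap\bigcap_{a\in A}\mathrm{Min}(a)$$ is non-empty, and the centralizer $C_\Lambda(A)=\{g\in\Lambda: ga=ag\ \forall a\in A\}$ acts co-compactly on $\mathrm{ConvHull}_\Omega(\mathrm{Min}_{\mathcal{C}}(A))$.
   Context: A properly convex domain $\Omega\subset\mathbb{P}(\mathbb{R}^d)$ is an open subset contained as a bounded convex set in some affine chart; $\mathrm{Aut}(\Omega)=\{g\in\mathrm{PGL}_d(\mathbb{R}):g\Omega=\Omega\}$. Hilbert metric: for distinct $x,y\in\Omega$, let $a,b$ be the points where the projective line through $x,y$ meets $\partial\Omega$, ordered $a,x,y,b$; $H_\Omega(x,y)=\frac12\log\frac{|x-b||y-a|}{|x-a||y-b|}$ (computed in an affine chart), $H_\Omega(x,x)=0$. For $g\in\mathrm{Aut}(\Omega)$, $\tau_\Omega(g)=\inf_{x\in\Omega}H_\Omega(x,gx)$ and $\mathrm{Min}(g)=\{x\in\Omega: H_\Omega(x,gx)=\tau_\Omega(g)\}$. A naive convex co-compact triple $(\Omega,\mathcal{C},\Lambda)$: $\Omega$ a properly convex domain, $\Lambda\le\mathrm{Aut}(\Omega)$ an infinite discrete subgroup, $\mathcal{C}\subset\Omega$ non-empty, closed in $\Omega$, convex, $\Lambda$-invariant with $\Lambda\backslash\mathcal{C}$ compact. For $X\subset\overline{\Omega}$, $\mathrm{ConvHull}_\Omega(X)$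 is the smallest convex subset of $\overline{\Omega}$ containing $X$. Co-compact action on $X$: there is a compact $K\subset X$ with $G\cdot K=X$. *)

(* Defs.v *)
From Stdlib Require Import Reals List Arith ClassicalEpsilon.
Open Scope R_scope.

(* Vectors of R^d are functions nat -> R whose coordinates >= d vanish;
   d x d matrices are functions nat -> nat -> R (only the block i,j < d matters). *)
Definition vec := nat -> R.
Definition mat := nat -> nat -> R.

Fixpoint fsum (n : nat) (f : nat -> R) : R :=
  match n with O => 0 | S m => fsum m f + f m end.

Definition inRd (d : nat) (v : vec) : Prop := forall i, (d <= i)%nat -> v i = 0.

Definition lin (d : nat) (phi v : vec) : R := fsum d (fun j => phi j * v j).

Definition mv (d : nat) (g : mat) (v : vec) : vec :=
  fun i => if Nat.ltb i d then fsum d (fun j => g i j * v j) else 0.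

Definition mmul (d : nat) (g h : mat) : mat :=
  fun i j => fsum d (fun k => g i k * h k j).

Definition mid : mat := fun i j => if Nat.eqb i j then 1 else 0.

Definition proj_eq (d : nat) (g h : mat) : Prop :=
  exists c, c <> 0 /\ forall i j, (i < d)%nat -> (j < d)%nat -> g i j = c * h i j.

Definition invertible (d : nat) (g : mat) : Prop :=
  exists h, forall i j, (i < d)%nat -> (j < d)%nat -> mmul d h g i j = mid i j.

(* A set of matrices representing a subgroup of PGL_d(R): it is a union of
   projective classes of invertible matrices, closed under identity, product, inverse. *)
Definition PGL_subgroup (d : nat) (L : mat -> Prop) : Prop :=
  (forall g, L g -> invertible d g) /\
  (forall g g', L g -> proj_eq d g' g -> L g') /\
  L mid /\
  (forall g h, L g -> L h -> L (mmul d g h)) /\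
  (forall g, L g -> exists h, L h /\
     forall i j, (i < d)%nat -> (j < d)%nat -> mmul d h g i j = mid i j).

Definition PGL_infinite (d : nat) (L : mat -> Prop) : Prop :=
  forall l : list mat, exists g, L g /\ forall h, In h l -> ~ proj_eq d g h.

(* discreteness in PGL_d(R): the identity class is isolated, i.e. there is no
   sequence of non-identity elements of L converging to [I] in PGL_d(R)
   (convergence in PGL_d(R) = convergence of suitable rescaled lifts in GL_d(R)). *)
Definition PGL_discrete (d : nat) (L : mat -> Prop) : Prop :=
  ~ exists (g : nat -> mat) (c : nat -> R),
      (forall n, L (g n) /\ ~ proj_eq d (g n) mid) /\
      (forall i j, (i < d)%nat -> (j < d)%nat ->
          Un_cv (fun n => c n * g n i j) (mid i j)).

(* ---- affine chart {[v] : lin phi v <> 0}, identified with {lin phi v = 1} ---- *)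
Definition inchart (d : nat) (phi x : vec) : Prop := inRd d x /\ lin d phi x = 1.

Definition comb (t : R) (x y : vec) : vec := fun i => (1 - t) * x i + t * y i.

Definition convex (S : vec -> Prop) : Prop :=
  forall x y t, S x -> S y -> 0 <= t <= 1 -> S (comb t x y).

Definition close (d : nat) (eps : R) (x y : vec) : Prop :=
  forall i, (i < d)%nat -> Rabs (x i - y i) < eps.

Definition properly_convex_domain (d : nat) (phi : vec) (O : vec -> Prop) : Prop :=
  (exists i, (i < d)%nat /\ phi i <> 0) /\
  (forall x, O x -> inchart d phi x) /\
  (exists x, O x) /\
  (forall x, O x -> exists eps, eps > 0 /\
      forall y, inchart d phi y -> close d eps x y -> O y) /\
  convex O /\
  (exists M, forall x i, O x -> Rabs (x i) <= M).

Definition closure (d : nat) (phi : vec) (O : vec -> Prop) (z : vec) : Prop :=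
  inchart d phi z /\ forall eps, eps > 0 -> exists x, O x /\ close d eps x z.

Definition boundary (d : nat) (phi : vec) (O : vec -> Prop) (z : vec) : Prop :=
  closure d phi O z /\ ~ O z.

Definition pact (d : nat) (phi : vec) (g : mat) (x : vec) : vec :=
  fun i => mv d g x i / lin d phi (mv d g x).

Definition Aut (d : nat) (phi : vec) (O : vec -> Prop) (g : mat) : Prop :=
  invertible d g /\
  (forall x, O x -> lin d phi (mv d g x) <> 0 /\ O (pact d phi g x)) /\
  (forall y, O y -> exists x, O x /\ pact d phi g x = y).

Definition dist (d : nat) (x y : vec) : R := sqrt (fsum d (fun i => (x i - y i) ^ 2)).

(* Hilbert metric: a = comb ta x y, b = comb tb x y with ta < 0 < 1 < tb are the
   points where the line through x, y meets the boundary, in the order a, x, y, b. *)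
Definition HilbertRel (d : nat) (phi : vec) (O : vec -> Prop) (x y : vec) (r : R) : Prop :=
  (x = y /\ r = 0) \/
  (x <> y /\ exists ta tb, ta < 0 /\ 1 < tb /\
     boundary d phi O (comb ta x y) /\ boundary d phi O (comb tb x y) /\
     r = / 2 * ln ((dist d x (comb tb x y) * dist d y (comb ta x y)) /
                   (dist d x (comb ta x y) * dist d y (comb tb x y)))).

Definition Hilbert (d : nat) (phi : vec) (O : vec -> Prop) (x y : vec) : R :=
  epsilon (inhabits 0) (HilbertRel d phi O x y).

Definition is_tau (d : nat) (phi : vec) (O : vec -> Prop) (g : mat) (t : R) : Prop :=
  (forall y, O y -> t <= Hilbert d phi O y (pact d phi g y)) /\
  (forall t', (forall y, O y -> t' <= Hilbert d phi O y (pact d phi g y)) -> t' <= t).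

Definition MinSet (d : nat) (phi : vec) (O : vec -> Prop) (g : mat) (x : vec) : Prop :=
  O x /\ exists t, is_tau d phi O g t /\ Hilbert d phi O x (pact d phi g x) = t.

(* sequential compactness in the chart (= compactness in P(R^d)) *)
Definition compact (d : nat) (K : vec -> Prop) : Prop :=
  forall u : nat -> vec, (forall n, K (u n)) ->
  exists (s : nat -> nat) z, (forall n, (s n < s (S n))%nat) /\ K z /\
     forall i, (i < d)%nat -> Un_cv (fun n => u (s n) i) (z i).

Definition cocompact (d : nat) (phi : vec) (G : mat -> Prop) (X : vec -> Prop) : Prop :=
  exists K, compact d K /\ (forall x, K x -> X x) /\
    (forall g k, G g -> K k -> X (pact d phi g k)) /\
    (forall x, X x -> exists g k, G g /\ K k /\ x = pact d phi g k).

Definition closed_in (d : nat) (O C : vec -> Prop) : Prop :=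
  forall x, O x -> (forall eps, eps > 0 -> exists c, C c /\ close d eps c x) -> C x.

Definition naive_ccc (d : nat) (phi : vec) (O C : vec -> Prop) (L : mat -> Prop) : Prop :=
  properly_convex_domain d phi O /\
  PGL_subgroup d L /\ (forall g, L g -> Aut d phi O g) /\
  PGL_infinite d L /\ PGL_discrete d L /\
  (exists x, C x) /\ (forall x, C x -> O x) /\ closed_in d O C /\ convex C /\
  (forall g x, L g -> C x -> C (pact d phi g x)) /\
  cocompact d phi L C.

Definition ConvHull (d : nat) (phi : vec) (O X : vec -> Prop) (z : vec) : Prop :=
  forall S : vec -> Prop, (forall y, S y -> closure d phi O y) -> convex S ->
    (forall y, X y -> S y) -> S z.

Definition centralizer (d : nat) (L A : mat -> Prop) (g : mat) : Prop :=
  L g /\ forall a, A a -> proj_eq d (mmul d g a) (mmul d a g).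

Definition MinC (d : nat) (phi : vec) (O C : vec -> Prop) (A : mat -> Prop) (x : vec) : Prop :=
  C x /\ forall a, A a -> MinSet d phi O a x.

(* Main.v *)
From Stdlib Require Import Reals Lra Lia Arith List Classical ClassicalEpsilon FunctionalExtensionality.
Require Import Defs.
Open Scope R_scope.

(** Let [<=] be the order of the closed cone over the domain and lift each automorphism to a linear
    map preserving that cone. The Hilbert distance satisfies [H(x, y) <= r] iff [x <= l y] and
    [y <= m x] for some [l m <= exp (2 r)], so displacements are governed by inequalities
    [g x <= b x]. If [g^N x <= b^N x], the truncated Neumann series
    [x + b^-1 g x + ... + b^-(N-1) g^(N-1) x] satisfies [g y <= b y], and it keeps the inequalities
    already obtained for maps commuting with [g]. Hence finitely many commuting automorphisms have
    simultaneous almost-minimizers, and these can be taken in the cone over [C]. Moreover [x] is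
    minimal for [g] iff [g x <= b x] and [g^-1 x <= c x] for all [b], [c] admissible at any point;
    these conditions are convex in [x], so [Min_C(A)] is its own convex hull.

    A finite list [F] in [A] spanning [A] linearly detects the centralizer of [A]. A sequence in [C]
    on which [F] has bounded displacement is moved into a compact set by elements of [L]; the
    conjugates of [F] so obtained lie in a finite set by discreteness, so after passing to a
    subsequence the movers differ by elements of the centralizer. Applied to almost-minimizing
    sequences this gives a point of [Min_C(A)], applied to arbitrary sequences in [Min_C(A)] it gives
    co-compactness. *)


(** * Vectors and matrices *)

(** The infimum behind [is_tau] runs over the whole domain, while the minimizer is wanted in [C].
    The Neumann series bridges this: started in the cone over [C] it stays there, because [C] is
    convex and invariant, yet it competes with every point of the domain. Infima of admissible
    constants need not be attained, so a factor [th > 1] is carried along and removed only by a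
    limit. No eigenvalue is used: growth of powers replaces spectral radii. A displacement involves
    the product of a constant for [g] and one for its inverse; the two can be optimized separately
    because both maps commute and hence have common almost-minimizers. Elements of [A] commute only
    up to a scalar in PGL; once they are lifted to maps of the cone, that scalar is 1. Finally,
    finite generation of [A] is not assumed: minimizing sequences exhaust [A] by growing finite
    lists, whereas bounded displacement is required only on the fixed list [F]. *)

Definition vadd (u v : vec) : vec := fun i => u i + v i.
Definition vscl (c : R) (v : vec) : vec := fun i => c * v i.
Definition vzero : vec := fun _ => 0.
Definition vbasis (j : nat) : vec := fun i => if Nat.eqb i j then 1 else 0.

Ltac vec_eq := let j := fresh "j" in extensionality j; unfold vadd, vscl, vzero, comb; try ring.

Lemma fsum_ext (n : nat) (f g : nat -> R) :
  (forall i, (i < n)%nat -> f i = g i) -> fsum n f = fsum n g.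
Proof.
  induction n as [|n IH]; intros H; simpl; [reflexivity|].
  rewrite IH by (intros; apply H; lia). rewrite H by lia. reflexivity.
Qed.

Lemma fsum_add (n : nat) (f g : nat -> R) :
  fsum n (fun i => f i + g i) = fsum n f + fsum n g.
Proof. induction n as [|n IH]; simpl; [ring|rewrite IH; ring]. Qed.

Lemma fsum_scl (n : nat) (c : R) (f : nat -> R) :
  fsum n (fun i => c * f i) = c * fsum n f.
Proof. induction n as [|n IH]; simpl; [ring|rewrite IH; ring]. Qed.

Lemma fsum_zero (n : nat) : fsum n (fun _ => 0) = 0.
Proof. induction n as [|n IH]; simpl; [ring|rewrite IH; ring]. Qed.

Lemma fsum_exchange (n m : nat) (f : nat -> nat -> R) :
  fsum n (fun i => fsum m (f i)) = fsum m (fun j => fsum n (fun i => f i j)).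
Proof.
  induction n as [|n IH]; simpl.
  - symmetry; apply fsum_zero.
  - rewrite IH, <- fsum_add. reflexivity.
Qed.

Lemma fsum_delta (n j : nat) (f : nat -> R) :
  (j < n)%nat -> fsum n (fun i => f i * vbasis j i) = f j.
Proof.
  unfold vbasis. induction n as [|n IH]; intros Hj; [lia|]. simpl.
  destruct (Nat.eq_dec j n) as [->|Hn].
  - rewrite Nat.eqb_refl, (fsum_ext _ _ (fun _ => 0)), fsum_zero; [ring|].
    intros i Hi. destruct (Nat.eqb_spec i n); [lia|ring].
  - rewrite IH by lia. destruct (Nat.eqb_spec n j); [lia|ring].
Qed.

Lemma fsum_abs_le (n : nat) (f g : nat -> R) :
  (forall i, (i < n)%nat -> Rabs (f i) <= g i) -> Rabs (fsum n f) <= fsum n g.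
Proof.
  induction n as [|n IH]; intros H; simpl; [rewrite Rabs_R0; lra|].
  eapply Rle_trans; [apply Rabs_triang|].
  apply Rplus_le_compat; [apply IH; intros|]; apply H; lia.
Qed.

Lemma lin_add (d : nat) (phi u v : vec) : lin d phi (vadd u v) = lin d phi u + lin d phi v.
Proof.
  unfold lin. rewrite <- fsum_add. apply fsum_ext. intros. unfold vadd. ring.
Qed.

Lemma lin_scl (d : nat) (phi : vec) (c : R) (v : vec) :
  lin d phi (vscl c v) = c * lin d phi v.
Proof.
  unfold lin. rewrite <- fsum_scl. apply fsum_ext. intros. unfold vscl. ring.
Qed.

Lemma lin_comb (d : nat) (phi : vec) (t : R) (x y : vec) :
  lin d phi (comb t x y) = (1 - t) * lin d phi x + t * lin d phi y.
Proof.
  change (comb t x y) with (vadd (vscl (1 - t) x) (vscl t y)).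
  rewrite lin_add, !lin_scl. ring.
Qed.

Lemma inRd_add (d : nat) (u v : vec) : inRd d u -> inRd d v -> inRd d (vadd u v).
Proof. intros Hu Hv i Hi. unfold vadd. rewrite Hu, Hv by assumption. ring. Qed.

Lemma inRd_scl (d : nat) (c : R) (v : vec) : inRd d v -> inRd d (vscl c v).
Proof. intros Hv i Hi. unfold vscl. rewrite Hv by assumption. ring. Qed.

Lemma inRd_comb (d : nat) (t : R) (x y : vec) : inRd d x -> inRd d y -> inRd d (comb t x y).
Proof. intros Hx Hy i Hi. unfold comb. rewrite Hx, Hy by assumption. ring. Qed.

Lemma inRd_basis (d j : nat) : (j < d)%nat -> inRd d (vbasis j).
Proof. intros Hj i Hi. unfold vbasis. destruct (Nat.eqb_spec i j); [lia|reflexivity]. Qed.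

Lemma inRd_ext (d : nat) (u v : vec) :
  inRd d u -> inRd d v -> (forall i, (i < d)%nat -> u i = v i) -> u = v.
Proof.
  intros Hu Hv H. extensionality i. destruct (le_lt_dec d i).
  - rewrite Hu, Hv by assumption. reflexivity.
  - auto.
Qed.

Lemma vec_bounded (d : nat) (v : vec) :
  exists B, 0 <= B /\ forall i, (i < d)%nat -> Rabs (v i) <= B.
Proof.
  induction d as [|n [B [HB H]]]; [exists 0; split; [lra|intros; lia]|].
  exists (B + Rabs (v n)). pose proof (Rabs_pos (v n)). split; [lra|].
  intros i Hi. destruct (Nat.eq_dec i n) as [->|]; [lra|].
  specialize (H i ltac:(lia)). lra.
Qed.

Lemma mv_inRd (d : nat) (g : mat) (v : vec) : inRd d (mv d g v).
Proof. intros i Hi. unfold mv. destruct (Nat.ltb_spec i d); [lia|reflexivity]. Qed.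

Lemma mv_lt (d : nat) (g : mat) (v : vec) (i : nat) :
  (i < d)%nat -> mv d g v i = fsum d (fun j => g i j * v j).
Proof. intros Hi. unfold mv. destruct (Nat.ltb_spec i d); [reflexivity|lia]. Qed.

Lemma mv_basis (d : nat) (g : mat) (i j : nat) :
  (i < d)%nat -> (j < d)%nat -> mv d g (vbasis j) i = g i j.
Proof. intros Hi Hj. rewrite mv_lt by assumption. apply (fsum_delta d j (g i)); assumption. Qed.

Lemma mv_add (d : nat) (g : mat) (u v : vec) :
  mv d g (vadd u v) = vadd (mv d g u) (mv d g v).
Proof.
  extensionality i. unfold vadd at 2. unfold mv. destruct (Nat.ltb i d); [|ring].
  rewrite <- fsum_add. apply fsum_ext. intros. unfold vadd. ring.
Qed.

Lemma mv_scl (d : nat) (g : mat) (c : R) (v : vec) :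
  mv d g (vscl c v) = vscl c (mv d g v).
Proof.
  extensionality i. unfold vscl at 2. unfold mv. destruct (Nat.ltb i d); [|ring].
  rewrite <- fsum_scl. apply fsum_ext. intros. unfold vscl. ring.
Qed.

Lemma mv_proj (d : nat) (g h : mat) (c : R) (v : vec) :
  (forall i j, (i < d)%nat -> (j < d)%nat -> g i j = c * h i j) ->
  mv d g v = vscl c (mv d h v).
Proof.
  intros H. extensionality i. unfold vscl, mv. destruct (Nat.ltb_spec i d); [|ring].
  rewrite <- fsum_scl. apply fsum_ext. intros j Hj. rewrite H by assumption. ring.
Qed.

Lemma mv_ext (d : nat) (g h : mat) (v : vec) :
  (forall i j, (i < d)%nat -> (j < d)%nat -> g i j = h i j) -> mv d g v = mv d h v.
Proof.
  intros H. rewrite (mv_proj d g h 1 v) by (intros; rewrite H by assumption; ring).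
  vec_eq.
Qed.

(** Leads back from actions on vectors, where all computations take place, to the entrywise relation
    behind [proj_eq]. *)
Lemma mat_ext_mv (d : nat) (g h : mat) (c : R) :
  (forall v, inRd d v -> mv d g v = vscl c (mv d h v)) ->
  forall i j, (i < d)%nat -> (j < d)%nat -> g i j = c * h i j.
Proof.
  intros H i j Hi Hj. rewrite <- (mv_basis d g i j), <- (mv_basis d h i j) by assumption.
  rewrite H by (apply inRd_basis; assumption). reflexivity.
Qed.

Lemma mv_mmul (d : nat) (g h : mat) (v : vec) :
  mv d (mmul d g h) v = mv d g (mv d h v).
Proof.
  extensionality i. unfold mv at 1 2. destruct (Nat.ltb_spec i d) as [Hi|]; [|reflexivity].
  unfold mmul.
  rewrite (fsum_ext d _ (fun j => fsum d (fun k => g i k * h k j * v j))).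
  2:{ intros j Hj. rewrite Rmult_comm, <- fsum_scl. apply fsum_ext. intros. ring. }
  rewrite fsum_exchange. apply fsum_ext. intros k Hk.
  rewrite mv_lt by assumption. rewrite <- fsum_scl. apply fsum_ext. intros. ring.
Qed.

Lemma mv_mid (d : nat) (v : vec) : inRd d v -> mv d mid v = v.
Proof.
  intros Hv. apply (inRd_ext d); [apply mv_inRd|assumption|]. intros i Hi.
  rewrite mv_lt by assumption. rewrite <- (fsum_delta d i v) by assumption.
  apply fsum_ext. intros j Hj. unfold mid, vbasis. rewrite Nat.eqb_sym. ring.
Qed.

(** Stated by the action on vectors because entries outside the d by d block are arbitrary, and
    two-sided because [PGL_subgroup] supplies only left inverses. *)
Definition inv_pair (d : nat) (g h : mat) : Prop :=
  (forall v, inRd d v -> mv d h (mv d g v) = v) /\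
  (forall v, inRd d v -> mv d g (mv d h v) = v).

Lemma inv_pair_sym (d : nat) (g h : mat) : inv_pair d g h -> inv_pair d h g.
Proof. intros [H1 H2]. split; assumption. Qed.

Definition iterv (d : nat) (g : mat) (n : nat) (v : vec) : vec := Nat.iter n (mv d g) v.

Lemma iterv_S (d : nat) (g : mat) (n : nat) (v : vec) :
  iterv d g (S n) v = mv d g (iterv d g n v).
Proof. reflexivity. Qed.

Lemma iterv_inRd (d : nat) (g : mat) (n : nat) (v : vec) :
  inRd d v -> inRd d (iterv d g n v).
Proof. intros Hv. destruct n; [exact Hv|apply mv_inRd]. Qed.

Lemma pow_ratio_unbounded (q k : R) : 1 < q -> exists n, (1 <= n)%nat /\ k <= q ^ n.
Proof.
  intros Hq. destruct (Pow_x_infinity q) with (b := k) as [N HN].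
  { rewrite Rabs_right; lra. }
  exists (S N). split; [lia|]. specialize (HN (S N) ltac:(lia)).
  rewrite Rabs_right in HN; [lra|]. apply Rle_ge, pow_le. lra.
Qed.

(** Exponential rates compare in spite of a constant factor; this takes the place of n-th roots in
    the spectral arguments. *)
Lemma pow_growth_le (a b c : R) :
  0 < a -> 0 < b -> (forall n, a ^ n <= c * b ^ n) -> a <= b.
Proof.
  intros Ha Hb H. apply Rnot_lt_le. intros Hlt.
  assert (Hq : 1 < a / b) by (apply Rmult_lt_reg_r with b; [lra|]; unfold Rdiv; rewrite Rmult_assoc, Rinv_l; lra).
  destruct (pow_ratio_unbounded (a / b) (c + 1) Hq) as (n & _ & Hn).
  specialize (H n). unfold Rdiv in Hn. rewrite Rpow_mult_distr, pow_inv in Hn.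
  assert (0 < b ^ n) by (apply pow_lt; lra).
  apply (Rmult_le_compat_r (b ^ n)) in Hn; [|lra].
  rewrite Rmult_assoc, Rinv_l in Hn by lra. lra.
Qed.

(** * Subsequences and spanning lists *)

Lemma choice_function (T U : Type) (P : T -> U -> Prop) :
  (forall x, exists y, P x y) -> exists f, forall x, P x (f x).
Proof.
  intros H. exists (fun x => proj1_sig (constructive_indefinite_description _ (H x))).
  intros x. apply (proj2_sig (constructive_indefinite_description _ (H x))).
Qed.

Definition strictly_increasing (s : nat -> nat) : Prop := forall n, (s n < s (S n))%nat.

Lemma strictly_increasing_ge (s : nat -> nat) (n : nat) : strictly_increasing s -> (n <= s n)%nat.
Proof. intros H. induction n; [lia|]. specialize (H n). lia. Qed.

Lemma strictly_increasing_lt (s : nat -> nat) (m n : nat) :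
  strictly_increasing s -> (m < n)%nat -> (s m < s n)%nat.
Proof. intros H Hmn. induction Hmn; [apply H|]. specialize (H m0). lia. Qed.

Lemma strictly_increasing_comp (s t : nat -> nat) :
  strictly_increasing s -> strictly_increasing t -> strictly_increasing (fun n => s (t n)).
Proof. intros Hs Ht n. apply strictly_increasing_lt; [assumption|apply Ht]. Qed.

Lemma cv_reindex (u : nat -> R) (l : R) (p : nat -> nat) :
  (forall n, (n <= p n)%nat) -> Un_cv u l -> Un_cv (fun n => u (p n)) l.
Proof.
  intros Hp H eps He. destruct (H eps He) as [N HN]. exists N. intros n Hn.
  apply HN. specialize (Hp n). lia.
Qed.

Lemma inv_INR_small (eps : R) : 0 < eps -> exists N, forall n, (N <= n)%nat -> / (INR n + 1) < eps.
Proof.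
  intros He. destruct (INR_unbounded (/ eps)) as [N HN]. exists N. intros n Hn.
  apply le_INR in Hn. rewrite <- (Rinv_inv eps).
  assert (0 < / eps) by (apply Rinv_0_lt_compat; assumption).
  apply Rinv_lt_contravar; [apply Rmult_lt_0_compat; lra|lra].
Qed.

(** Bolzano-Weierstrass provides a cluster value [l]. The subsequence is built by recursion,
    choosing an index beyond the previous one at which [u] is within [/ (INR n + 1)] of [l]. *)
Lemma bounded_subseq (u : nat -> R) (B : R) :
  (forall n, Rabs (u n) <= B) ->
  exists s l, strictly_increasing s /\ Un_cv (fun n => u (s n)) l.
Proof.
  intros HB.
  destruct (Bolzano_Weierstrass u (fun c => - B <= c <= B) (compact_P3 (- B) B)) as [l Hl].
  { intros n. specialize (HB n). revert HB. unfold Rabs. destruct (Rcase_abs (u n)); lra. }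
  assert (Hch : forall q : nat * nat, exists p,
             (snd q <= p)%nat /\ Rabs (u p - l) < / (INR (fst q) + 1)).
  { intros [n N]. simpl.
    assert (Hp : 0 < / (INR n + 1)) by (apply Rinv_0_lt_compat; pose proof (pos_INR n); lra).
    destruct (Hl (disc l (mkposreal _ Hp)) N) as (p & Hp1 & Hp2).
    - exists (mkposreal _ Hp). intros y Hy; exact Hy.
    - exists p. split; [assumption|exact Hp2]. }
  destruct (choice_function _ _ _ Hch) as [f Hf].
  set (s := fix s n := match n with 0%nat => f (0%nat, 0%nat) | S m => f (S m, S (s m)) end).
  exists s, l. split.
  - intros n. destruct (Hf (S n, S (s n))) as [H _]. simpl in *. lia.
  - intros eps He. destruct (inv_INR_small eps He) as [N HN]. exists N. intros n Hn.
    eapply Rlt_trans; [|apply (HN n Hn)].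
    destruct n; unfold R_dist.
    + apply (Hf (0%nat, 0%nat)).
    + apply (Hf (S n, S (s n))).
Qed.

(** The index type is left open so that the lemma serves both coordinates of vectors and entries of
    matrices. *)
Lemma family_subseq (I : Type) (l : list I) (u : nat -> I -> R) :
  (forall i, In i l -> exists B, forall n, Rabs (u n i) <= B) ->
  exists s, strictly_increasing s /\
    forall i, In i l -> exists z, Un_cv (fun n => u (s n) i) z.
Proof.
  induction l as [|i l IH]; intros H.
  - exists (fun n => n). split; [intros n; lia|intros i []].
  - destruct IH as (s & Hs & Hcv); [intros; apply H; right; assumption|].
    destruct (H i (or_introl eq_refl)) as [B HB].
    destruct (bounded_subseq (fun n => u (s n) i) B) as (t & z & Ht & Hz); [intros; apply HB|].
    exists (fun n => s (t n)). split; [apply strictly_increasing_comp; assumption|].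
    intros j [<-|Hj]; [exists z; exact Hz|]. destruct (Hcv j Hj) as [z' Hz'].
    exists z'. apply (cv_reindex (fun n => u (s n) j)); [|assumption].
    intros n. apply strictly_increasing_ge, Ht.
Qed.

Lemma cv_fsum (d : nat) (f : nat -> nat -> R) (l : nat -> R) :
  (forall i, (i < d)%nat -> Un_cv (f i) (l i)) ->
  Un_cv (fun n => fsum d (fun i => f i n)) (fsum d l).
Proof.
  induction d as [|d IH]; intros H; simpl.
  - intros eps He. exists 0%nat. intros n _. rewrite Rdist_eq. assumption.
  - apply CV_plus; [apply IH; intros; apply H; lia|apply H; lia].
Qed.

Lemma cv_scl (u : nat -> R) (l c : R) : Un_cv u l -> Un_cv (fun n => c * u n) (c * l).
Proof.
  intros H. apply (CV_mult (fun _ => c) u c l); [|assumption].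
  intros eps He. exists 0%nat. intros n _. rewrite Rdist_eq. assumption.
Qed.

Definition vcv (d : nat) (u : nat -> vec) (z : vec) : Prop :=
  forall i, (i < d)%nat -> Un_cv (fun n => u n i) (z i).

Lemma vcv_close (d : nat) (u : nat -> vec) (z : vec) (eps : R) :
  vcv d u z -> 0 < eps -> exists N, forall n, (N <= n)%nat -> close d eps (u n) z.
Proof.
  intros H He. induction d as [|d IH]; [exists 0%nat; intros n _ i Hi; lia|].
  destruct IH as [N HN]; [intros i Hi; apply H; lia|].
  destruct (H d ltac:(lia) eps He) as [N' HN'].
  exists (N + N')%nat. intros n Hn i Hi. destruct (Nat.eq_dec i d) as [->|].
  - apply HN'. lia.
  - apply HN; lia.
Qed.

Lemma vcv_mv (d : nat) (g : mat) (u : nat -> vec) (z : vec) :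
  vcv d u z -> vcv d (fun n => mv d g (u n)) (mv d g z).
Proof.
  intros H i Hi. rewrite mv_lt by assumption.
  replace (fun n => mv d g (u n) i) with (fun n => fsum d (fun j => g i j * u n j)).
  - apply (cv_fsum d (fun j n => g i j * u n j)). intros j Hj. apply cv_scl, H, Hj.
  - extensionality n. rewrite mv_lt by assumption. reflexivity.
Qed.

Lemma vcv_scl (d : nat) (c : R) (u : nat -> vec) (z : vec) :
  vcv d u z -> vcv d (fun n => vscl c (u n)) (vscl c z).
Proof. intros H i Hi. apply cv_scl, H, Hi. Qed.

Lemma vcv_const (d : nat) (z : vec) : vcv d (fun _ => z) z.
Proof. intros i Hi eps He. exists 0%nat. intros n _. rewrite Rdist_eq. assumption. Qed.

Lemma vcv_lin (d : nat) (phi : vec) (u : nat -> vec) (z : vec) :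
  vcv d u z -> Un_cv (fun n => lin d phi (u n)) (lin d phi z).
Proof.
  intros H. apply (cv_fsum d (fun j n => phi j * u n j)). intros j Hj. apply cv_scl, H, Hj.
Qed.

Inductive mspan (S : mat -> Prop) : mat -> Prop :=
| mspan_zero : mspan S (fun _ _ => 0)
| mspan_add (c : R) (x v : mat) : S x -> mspan S v -> mspan S (fun i j => v i j + c * x i j).

(** Undoes an elimination step: each reduced generator is an original one plus a multiple of the
    pivot. *)
Lemma mspan_comb (S T : mat -> Prop) (v : mat) :
  (forall x, S x -> exists y y0 k, T y /\ T y0 /\ x = (fun i j => y i j + k * y0 i j)) ->
  mspan S v -> mspan T v.
Proof.
  intros H Hv. induction Hv as [|c x v Hx Hv IH]; [constructor|].
  destruct (H x Hx) as (y & y0 & k & Hy & Hy0 & ->).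
  replace (fun i j => v i j + c * (y i j + k * y0 i j)) with
    (fun i j => (v i j + c * y i j) + (c * k) * y0 i j).
  - apply (mspan_add T (c * k) y0 (fun i j => v i j + c * y i j)); [assumption|].
    apply mspan_add; assumption.
  - extensionality i. extensionality j. ring.
Qed.

Lemma mspan_entry_zero (S : mat -> Prop) (v : mat) (p : nat * nat) :
  (forall x, S x -> x (fst p) (snd p) = 0) -> mspan S v -> v (fst p) (snd p) = 0.
Proof.
  intros H Hv. induction Hv as [|c x v Hx Hv IH]; [reflexivity|].
  rewrite IH, H by assumption. ring.
Qed.

(* Gaussian elimination, one matrix entry at a time. *)
Lemma spanning_list (ps : list (nat * nat)) (S : mat -> Prop) :
  exists l, (forall x, In x l -> S x) /\
    forall s, S s -> exists s', mspan (fun x => In x l) s' /\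
      forall p, In p ps -> s (fst p) (snd p) = s' (fst p) (snd p).
Proof.
  revert S. induction ps as [|p ps IH]; intros S.
  - exists nil. split; [intros x []|]. intros s Hs. exists (fun _ _ => 0).
    split; [constructor|intros p []].
  - destruct (classic (exists s0, S s0 /\ s0 (fst p) (snd p) <> 0)) as [(s0 & Hs0 & Hp0)|Hno].
    + set (e := fun x : mat => x (fst p) (snd p)) in *. change (e s0 <> 0) in Hp0.
      set (red := fun s : mat => (fun i j => s i j + - (e s / e s0) * s0 i j) : mat).
      destruct (IH (fun x => exists s, S s /\ x = red s)) as (l & Hl & Hspan).
      (* The recursive list consists of reduced matrices; [f] chooses for each an element of [S]
         that reduces to it. *)
      destruct (choice_function mat mat (fun x s => In x l -> S s /\ x = red s)) as [f Hf].
      { intros x. destruct (classic (In x l)) as [Hx|Hx].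
        - destruct (Hl x Hx) as (s & Hs). exists s. auto.
        - exists x. intros; contradiction. }
      exists (s0 :: map f l). split.
      * intros x [<-|Hx]; [assumption|]. apply in_map_iff in Hx.
        destruct Hx as (y & <- & Hy). apply (Hf y Hy).
      * intros s Hs. destruct (Hspan (red s)) as (s' & Hs' & Heq); [exists s; auto|].
        exists (fun i j => s' i j + (e s / e s0) * s0 i j). split.
        -- apply mspan_add; [left; reflexivity|]. revert Hs'. apply mspan_comb.
           intros x Hx. exists (f x), s0, (- (e (f x) / e s0)).
           split; [right; apply in_map, Hx|]. split; [left; reflexivity|]. apply (Hf x Hx).
        -- intros q Hq. assert (Hq' : red s (fst q) (snd q) = s' (fst q) (snd q)).
           { destruct Hq as [<-|Hq]; [|apply Heq, Hq].
             (* At the pivot entry both sides vanish: every reduced matrix is zero there, hence so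
                is their span. *)
             rewrite (mspan_entry_zero _ s' p) with (2 := Hs').
             - unfold red. change (e s + - (e s / e s0) * e s0 = 0). field. assumption.
             - intros x Hx. destruct (Hl x Hx) as (t & _ & ->). unfold red.
               change (e t + - (e t / e s0) * e s0 = 0). field. assumption. }
           rewrite <- Hq'. unfold red. ring.
    + destruct (IH S) as (l & Hl & Hspan). exists l. split; [assumption|].
      assert (Hz : forall x, S x -> x (fst p) (snd p) = 0).
      { intros x Hx. apply NNPP. intros Hn. apply Hno. exists x. auto. }
      intros s Hs. destruct (Hspan s Hs) as (s' & Hs' & Heq). exists s'. split; [assumption|].
      intros q [<-|Hq]; [|auto]. rewrite Hz by assumption. symmetry.
      apply (mspan_entry_zero (fun x => In x l)); auto.
Qed.

Definition mcommute (d : nat) (g h : mat) : Prop :=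
  forall v, inRd d v -> mv d g (mv d h v) = mv d h (mv d g v).

Lemma mcommute_mspan (d : nat) (S : mat -> Prop) (g v : mat) :
  (forall x, S x -> mcommute d g x) -> mspan S v -> mcommute d g v.
Proof.
  intros H Hv. induction Hv as [|c x v Hx Hv IH]; intros w Hw.
  - rewrite !(mv_proj d (fun _ _ => 0) mid 0) by (intros; ring). rewrite mv_scl, !mv_mid.
    + reflexivity.
    + apply mv_inRd.
    + assumption.
  - assert (E : forall u, mv d (fun i j => v i j + c * x i j) u
                          = vadd (mv d v u) (vscl c (mv d x u))).
    { intros u. extensionality i. unfold vadd, vscl, mv.
      destruct (Nat.ltb i d); [|ring]. rewrite <- fsum_scl, <- fsum_add.
      apply fsum_ext. intros. ring. }
    rewrite !E, mv_add, mv_scl, (H x Hx), IH by assumption. reflexivity.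
Qed.

Lemma commutant_list (d : nat) (S : mat -> Prop) :
  exists l, (forall x, In x l -> S x) /\
    forall g, (forall x, In x l -> mcommute d g x) -> forall s, S s -> mcommute d g s.
Proof.
  destruct (spanning_list (list_prod (seq 0 d) (seq 0 d)) S) as (l & Hl & H).
  exists l. split; [assumption|]. intros g Hg s Hs.
  destruct (H s Hs) as (s' & Hs' & Heq).
  assert (E : forall u, mv d s u = mv d s' u).
  { intros u. apply mv_ext. intros i j Hi Hj. apply (Heq (i, j)).
    apply in_prod; apply in_seq; lia. }
  assert (Hc : mcommute d g s') by (eapply mcommute_mspan; [|exact Hs']; exact Hg).
  intros v Hv. rewrite !E. apply Hc, Hv.
Qed.

(** * The cone over a properly convex domain *)

Section Cone.

Context (d : nat) (phi : vec) (Om : vec -> Prop).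
Hypothesis Hdom : properly_convex_domain d phi Om.

Definition vnormalize (v : vec) : vec := vscl (/ lin d phi v) v.

(** Among the two opposite cones over [X], the one where [phi] is positive. It is used for [Om] and
    for [C] alike. *)
Definition cone (X : vec -> Prop) (v : vec) : Prop :=
  inRd d v /\ 0 < lin d phi v /\ X (vnormalize v).

(** The closure of the open cone, encoded as the vectors whose translation maps the open cone into
    itself. Stability under sums is then immediate, and topological closedness follows from openness
    of the cone. *)
Definition ccone (v : vec) : Prop :=
  inRd d v /\ forall w, cone Om w -> cone Om (vadd v w).

Definition cle (u v : vec) : Prop := ccone (vadd v (vscl (-1) u)).

Lemma domain_chart (x : vec) : Om x -> inRd d x /\ lin d phi x = 1.
Proof. destruct Hdom as (_ & H & _). apply H. Qed.

Lemma cone_inRd (X : vec -> Prop) (v : vec) : cone X v -> inRd d v.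
Proof. intros H; apply H. Qed.

Lemma cone_of_set (X : vec -> Prop) (x : vec) : (forall y, X y -> Om y) -> X x -> cone X x.
Proof.
  intros HX Hx. destruct (domain_chart x (HX x Hx)) as [H1 H2].
  split; [assumption|]. unfold vnormalize. rewrite H2. split; [lra|].
  replace (vscl (/ 1) x) with x by (vec_eq; field). assumption.
Qed.

Lemma cone_of_domain (x : vec) : Om x -> cone Om x.
Proof. apply cone_of_set. auto. Qed.

Lemma vnormalize_scl (c : R) (v : vec) :
  c <> 0 -> lin d phi v <> 0 -> vnormalize (vscl c v) = vnormalize v.
Proof. intros Hc Hv. unfold vnormalize. rewrite lin_scl. vec_eq. field; auto. Qed.

Lemma cone_scl (X : vec -> Prop) (c : R) (v : vec) :
  0 < c -> cone X v -> cone X (vscl c v).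
Proof.
  intros Hc (H1 & H2 & H3). split; [apply inRd_scl; assumption|].
  rewrite vnormalize_scl by lra. rewrite lin_scl.
  split; [apply Rmult_lt_0_compat; assumption|assumption].
Qed.

Lemma cone_scl_inv (X : vec -> Prop) (c : R) (v : vec) :
  0 < c -> cone X (vscl c v) -> cone X v.
Proof.
  intros Hc H. replace v with (vscl (/ c) (vscl c v)) by (vec_eq; field; lra).
  apply cone_scl; [apply Rinv_0_lt_compat; assumption|assumption].
Qed.

(** The normalization of a sum is the convex combination of the normalizations, weighted by the
    values of [phi]. *)
Lemma cone_add (X : vec -> Prop) (u v : vec) :
  convex X -> cone X u -> cone X v -> cone X (vadd u v).
Proof.
  intros HX (H1 & H2 & H3) (H4 & H5 & H6).
  split; [apply inRd_add; assumption|]. rewrite lin_add. split; [lra|].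
  replace (vnormalize (vadd u v)) with
    (comb (lin d phi v / (lin d phi u + lin d phi v)) (vnormalize u) (vnormalize v)).
  - apply HX; try assumption. split.
    + apply Rlt_le, Rdiv_lt_0_compat; lra.
    + apply Rmult_le_reg_r with (lin d phi u + lin d phi v); [lra|].
      unfold Rdiv. rewrite Rmult_assoc, Rinv_l; lra.
  - unfold vnormalize. rewrite lin_add. vec_eq. field. lra.
Qed.

Lemma domain_convex : convex Om.
Proof. apply Hdom. Qed.

Lemma coneO_add (u v : vec) : cone Om u -> cone Om v -> cone Om (vadd u v).
Proof. apply cone_add, domain_convex. Qed.

Lemma domain_of_cone (x : vec) : cone Om x -> lin d phi x = 1 -> Om x.
Proof.
  intros (_ & _ & H) Hx. unfold vnormalize in H. rewrite Hx in H.
  replace (vscl (/ 1) x) with x in H by (vec_eq; field). assumption.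
Qed.

Lemma lin_abs_le (v : vec) (e : R) :
  (forall i, (i < d)%nat -> Rabs (v i) <= e) ->
  Rabs (lin d phi v) <= fsum d (fun j => Rabs (phi j)) * e.
Proof.
  intros H. unfold lin. rewrite Rmult_comm, <- fsum_scl.
  apply fsum_abs_le. intros i Hi. rewrite Rabs_mult, Rmult_comm.
  apply Rmult_le_compat_r; [apply Rabs_pos|auto].
Qed.

Lemma cone_bound : exists M, 0 < M /\ forall v i, cone Om v -> Rabs (v i) <= M * lin d phi v.
Proof.
  destruct Hdom as (_ & _ & _ & _ & _ & M & HM).
  exists (Rabs M + 1). split; [pose proof (Rabs_pos M); lra|].
  intros v i (H1 & H2 & H3). specialize (HM _ i H3). unfold vnormalize, vscl in HM.
  rewrite Rabs_mult, Rabs_right in HM by (apply Rle_ge, Rlt_le, Rinv_0_lt_compat; assumption).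
  assert (Rabs (v i) <= M * lin d phi v).
  { apply Rmult_le_reg_l with (/ lin d phi v); [apply Rinv_0_lt_compat; assumption|].
    eapply Rle_trans; [exact HM|]. right; field; lra. }
  eapply Rle_trans; [exact H|]. apply Rmult_le_compat_r; [lra|].
  pose proof (Rle_abs M). lra.
Qed.

(* A perturbation [e] of [w] is split along [w] as [lin e * w + e'] with [lin e' = 0], which
   reduces openness of the cone to openness of the domain inside the chart. *)
Lemma cone_open (w : vec) :
  cone Om w -> exists eps, 0 < eps /\
    forall e, inRd d e -> (forall i, (i < d)%nat -> Rabs (e i) <= eps) -> cone Om (vadd w e).
Proof.
  intros (H1 & H2 & H3). set (l := lin d phi w) in *.
  destruct Hdom as (_ & _ & _ & Hop & _ & M & HM).
  destruct (Hop _ H3) as (r & Hr & Hball).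
  set (P := fsum d (fun j => Rabs (phi j))).
  assert (HP : 0 <= P).
  { eapply Rle_trans; [apply Rabs_pos|apply (fsum_abs_le d phi)]. intros; lra. }
  assert (HM0 : 0 <= M) by (eapply Rle_trans; [apply Rabs_pos|apply (HM _ 0%nat H3)]).
  (* With [eps = l * q / (P + 1)], the change of [phi] is at most [l * q <= l / 2], and the
     displacement in the chart is at most [2 * (M + 1) * q <= Q * q <= r / 2]. *)
  set (Q := 2 * (P + 1) * (M + 1)).
  assert (HQ : 0 < Q) by (unfold Q; apply Rmult_lt_0_compat; lra).
  set (q := Rmin (/ 2) (r / (2 * Q))).
  assert (Hq : 0 < q).
  { unfold q. apply Rmin_glb_lt; [lra|]. apply Rdiv_lt_0_compat; lra. }
  assert (Hq1 : q <= / 2) by apply Rmin_l.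
  assert (Hq2 : 2 * Q * q <= r).
  { assert (q <= r / (2 * Q)) by apply Rmin_r.
    apply (Rmult_le_compat_l (2 * Q)) in H; [|lra].
    replace (2 * Q * (r / (2 * Q))) with r in H by (field; lra). assumption. }
  set (eps := l * q / (P + 1)).
  assert (Heps : 0 < eps) by (unfold eps; apply Rdiv_lt_0_compat; [apply Rmult_lt_0_compat|]; lra).
  assert (HPe : (P + 1) * eps = l * q) by (unfold eps; field; lra).
  exists eps. split; [assumption|]. intros e He Hes.
  assert (Hle : Rabs (lin d phi e) <= P * eps) by (apply lin_abs_le; assumption).
  set (le := lin d phi e) in *.
  assert (Hlq : l * q <= l / 2) by (unfold Rdiv; apply Rmult_le_compat_l; lra).
  assert (Hlow : l / 2 <= l + le).
  { pose proof (Rle_abs (- le)). rewrite Rabs_Ropp in H. nra. }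
  split; [apply inRd_add; assumption|]. rewrite lin_add. fold l le. split; [lra|].
  apply Hball.
  - split; [apply inRd_scl, inRd_add; assumption|].
    unfold vnormalize. rewrite lin_scl, lin_add. fold l le. field. lra.
  - intros i Hi. unfold vnormalize. rewrite lin_add. unfold vscl, vadd. fold l le.
    replace (/ l * w i - / (l + le) * (w i + e i)) with
      (/ (l + le) * (le * (/ l * w i) - e i)) by (field; lra).
    rewrite Rabs_mult, Rabs_right by (apply Rle_ge, Rlt_le, Rinv_0_lt_compat; lra).
    apply Rmult_lt_reg_l with (l + le); [lra|].
    rewrite <- Rmult_assoc, Rinv_r, Rmult_1_l by lra.
    assert (Hw : Rabs (/ l * w i) <= M) by (apply (HM _ i H3)).
    assert (Rabs (le * (/ l * w i) - e i) <= P * eps * M + eps).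
    { eapply Rle_trans; [apply Rabs_triang|]. rewrite Rabs_Ropp, Rabs_mult.
      apply Rplus_le_compat; [|auto].
      apply Rmult_le_compat; auto using Rabs_pos. }
    assert (P * eps * M + eps <= (P + 1) * eps * (M + 1)) by nra.
    assert (l / 2 * (2 * Q * q) <= (l + le) * r) by (apply Rmult_le_compat; nra).
    assert (l * q * (M + 1) < l / 2 * (2 * Q * q)).
    { replace (l / 2 * (2 * Q * q)) with (l * q * Q) by field.
      assert (0 < l * q) by nra. apply Rmult_lt_compat_l; [lra|]. unfold Q. nra. }
    rewrite HPe in H0. lra.
Qed.

Lemma ccone_of_cone (v : vec) : cone Om v -> ccone v.
Proof. intros H. split; [apply H|]. intros w Hw. apply coneO_add; assumption. Qed.

Lemma ccone_zero : ccone vzero.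
Proof.
  split; [intros i _; reflexivity|]. intros w Hw.
  replace (vadd vzero w) with w by vec_eq. assumption.
Qed.

Lemma ccone_add (u v : vec) : ccone u -> ccone v -> ccone (vadd u v).
Proof.
  intros [H1 H2] [H3 H4]. split; [apply inRd_add; assumption|]. intros w Hw.
  replace (vadd (vadd u v) w) with (vadd u (vadd v w)) by vec_eq. auto.
Qed.

Lemma ccone_scl (c : R) (v : vec) : 0 <= c -> ccone v -> ccone (vscl c v).
Proof.
  intros Hc [H1 H2]. destruct (Req_dec c 0) as [->|Hn].
  - replace (vscl 0 v) with vzero by vec_eq. apply ccone_zero.
  - split; [apply inRd_scl; assumption|]. intros w Hw.
    replace (vadd (vscl c v) w) with (vscl c (vadd v (vscl (/ c) w))) by (vec_eq; field; lra).
    apply cone_scl; [lra|]. apply H2, cone_scl; [apply Rinv_0_lt_compat; lra|assumption].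
Qed.

(** The error is absorbed by the open summand: [v + w] equals [u + (w + (v - u))], and [w + (v - u)]
    is still in the open cone when [u] is close to [v]. *)
Lemma ccone_closed (v : vec) :
  inRd d v -> (forall eps, 0 < eps -> exists u, ccone u /\ close d eps u v) -> ccone v.
Proof.
  intros Hv H. split; [assumption|]. intros w Hw.
  destruct (cone_open w Hw) as (eps & Heps & Hb).
  destruct (H eps Heps) as (u & [Hu1 Hu2] & Hc).
  replace (vadd v w) with (vadd u (vadd w (vadd v (vscl (-1) u)))) by vec_eq.
  apply Hu2, Hb.
  - apply inRd_add; [assumption|apply inRd_scl; assumption].
  - intros i Hi. specialize (Hc i Hi). rewrite Rabs_minus_sym in Hc. unfold vadd, vscl.
    replace (v i + -1 * u i) with (v i - u i) by ring. lra.
Qed.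

Lemma domain_inhabited : exists x, Om x.
Proof. apply Hdom. Qed.

(** For [v] in the closed cone, [v + s x] lies in the open cone for every [s > 0]; the bounds valid
    there pass to the limit [s -> 0]. *)
Lemma ccone_bound : exists M, 0 < M /\
  forall v, ccone v -> 0 <= lin d phi v /\ forall i, Rabs (v i) <= M * lin d phi v.
Proof.
  destruct cone_bound as (M & HM & Hb). exists M. split; [assumption|].
  intros v [H1 H2]. destruct domain_inhabited as [x Hx].
  assert (Hcx := cone_of_domain x Hx). destruct (domain_chart x Hx) as [_ Hlx].
  assert (Hs : forall s, 0 < s -> cone Om (vadd v (vscl s x))).
  { intros s Hs. apply H2, cone_scl; assumption. }
  assert (Hl : 0 <= lin d phi v).
  { apply Rnot_lt_le. intros Hn. destruct (Hs (- lin d phi v) ltac:(lra)) as (_ & Hp & _).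
    rewrite lin_add, lin_scl in Hp. nra. }
  split; [assumption|]. intros i. apply le_epsilon. intros e He.
  set (s := e / (M + Rabs (x i) + 1)).
  pose proof (Rabs_pos (x i)).
  assert (Hs0 : 0 < s) by (unfold s; apply Rdiv_lt_0_compat; lra).
  assert (Hse : s * (M + Rabs (x i) + 1) = e) by (unfold s; field; lra).
  specialize (Hb _ i (Hs s Hs0)). rewrite lin_add, lin_scl, Hlx in Hb.
  replace (v i) with (vadd v (vscl s x) i + - (s * x i)) by (unfold vadd, vscl; ring).
  eapply Rle_trans; [apply Rabs_triang|].
  rewrite Rabs_Ropp, Rabs_mult, (Rabs_right s) by lra. nra.
Qed.

Lemma ccone_lin (v : vec) : ccone v -> 0 <= lin d phi v.
Proof. destruct ccone_bound as (M & _ & H). intros Hv. apply H, Hv. Qed.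

(** Boundedness of the domain makes the closed cone pointed. *)
Lemma ccone_lin0 (v : vec) : ccone v -> lin d phi v = 0 -> v = vzero.
Proof.
  destruct ccone_bound as (M & _ & H). intros Hv H0. extensionality i.
  destruct (H v Hv) as [_ Hi]. specialize (Hi i). rewrite H0, Rmult_0_r in Hi.
  unfold vzero. destruct (Req_dec (v i) 0) as [|Hn]; [assumption|].
  apply Rabs_pos_lt in Hn. lra.
Qed.

(** Points of the open cone are order units: a vector scaled down to the size [eps] of the ball
    around [w] can be subtracted from [w]. The constant is uniform in [v], as the compactness
    arguments require. *)
Lemma cone_absorbs (w : vec) :
  cone Om w -> exists k, 0 < k /\ forall v B, 0 <= B -> inRd d v ->
    (forall i, (i < d)%nat -> Rabs (v i) <= B) -> cle v (vscl (k * B) w).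
Proof.
  intros Hw. destruct (cone_open w Hw) as (eps & He & Hb).
  exists (/ eps). assert (Hk : 0 < / eps) by (apply Rinv_0_lt_compat; assumption).
  split; [assumption|]. intros v B HB Hv Hvb. unfold cle.
  destruct (Req_dec B 0) as [->|HBn].
  - replace v with vzero. 2:{ apply (inRd_ext d); [intros i _; reflexivity|assumption|].
      intros i Hi. specialize (Hvb i Hi). unfold vzero.
      destruct (Req_dec (v i) 0) as [|Hn]; [auto|]. apply Rabs_pos_lt in Hn; lra. }
    replace (vadd (vscl (/ eps * 0) w) (vscl (-1) vzero)) with vzero by vec_eq.
    apply ccone_zero.
  - assert (0 < / eps * B) by (apply Rmult_lt_0_compat; lra).
    replace (vadd (vscl (/ eps * B) w) (vscl (-1) v)) with
      (vscl (/ eps * B) (vadd w (vscl (- (eps / B)) v))) by (vec_eq; field; lra).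
    apply ccone_of_cone, cone_scl; [assumption|]. apply Hb; [apply inRd_scl; assumption|].
    intros i Hi. unfold vscl. assert (0 < eps / B) by (apply Rdiv_lt_0_compat; lra).
    rewrite Rabs_mult, Rabs_Ropp, Rabs_right by lra.
    replace eps with (eps / B * B) at 2 by (field; assumption).
    apply Rmult_le_compat_l; [lra|auto].
Qed.

(** * The order of the closed cone *)

Lemma cle_refl (u : vec) : cle u u.
Proof.
  unfold cle. replace (vadd u (vscl (-1) u)) with vzero by vec_eq. apply ccone_zero.
Qed.

Lemma cle_trans (u v w : vec) : cle u v -> cle v w -> cle u w.
Proof.
  unfold cle. intros H1 H2.
  replace (vadd w (vscl (-1) u)) with (vadd (vadd v (vscl (-1) u)) (vadd w (vscl (-1) v))) by vec_eq.
  apply ccone_add; assumption.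
Qed.

Lemma cle_scl (c : R) (u v : vec) : 0 <= c -> cle u v -> cle (vscl c u) (vscl c v).
Proof.
  unfold cle. intros Hc H.
  replace (vadd (vscl c v) (vscl (-1) (vscl c u))) with (vscl c (vadd v (vscl (-1) u))) by vec_eq.
  apply ccone_scl; assumption.
Qed.

Lemma cle_add (u v u' v' : vec) : cle u v -> cle u' v' -> cle (vadd u u') (vadd v v').
Proof.
  unfold cle. intros H1 H2.
  replace (vadd (vadd v v') (vscl (-1) (vadd u u'))) with
    (vadd (vadd v (vscl (-1) u)) (vadd v' (vscl (-1) u'))) by vec_eq.
  apply ccone_add; assumption.
Qed.

Lemma cle_scl_mono (a b : R) (v : vec) : a <= b -> ccone v -> cle (vscl a v) (vscl b v).
Proof.
  intros Hab Hv. unfold cle.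
  replace (vadd (vscl b v) (vscl (-1) (vscl a v))) with (vscl (b - a) v) by vec_eq.
  apply ccone_scl; [lra|assumption].
Qed.

Lemma cle_weaken (u v : vec) (a b : R) : a <= b -> ccone v -> cle u (vscl a v) -> cle u (vscl b v).
Proof. intros H1 H2 H3. eapply cle_trans; [exact H3|apply cle_scl_mono; assumption]. Qed.

Lemma cle_scl_chain (u v w : vec) (a b : R) :
  0 <= a -> cle u (vscl a v) -> cle v (vscl b w) -> cle u (vscl (a * b) w).
Proof.
  intros Ha H1 H2. eapply cle_trans; [exact H1|].
  replace (vscl (a * b) w) with (vscl a (vscl b w)) by vec_eq.
  apply cle_scl; assumption.
Qed.

Lemma cle_unscl (c : R) (u v : vec) : 0 < c -> cle (vscl c u) (vscl c v) -> cle u v.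
Proof.
  intros Hc H. apply (cle_scl (/ c)) in H; [|apply Rlt_le, Rinv_0_lt_compat; assumption].
  replace u with (vscl (/ c) (vscl c u)) by (vec_eq; field; lra).
  replace v with (vscl (/ c) (vscl c v)) by (vec_eq; field; lra). assumption.
Qed.

Lemma cle_scl_le (a b : R) (v : vec) : cone Om v -> cle (vscl a v) (vscl b v) -> a <= b.
Proof.
  intros (_ & Hl & _) H. apply ccone_lin in H. rewrite lin_add, !lin_scl in H. nra.
Qed.

Lemma cle_unit (v w : vec) : cone Om w -> inRd d v -> exists k, 0 < k /\ cle v (vscl k w).
Proof.
  intros Hw Hv. destruct (cone_absorbs w Hw) as (k & Hk & H).
  destruct (vec_bounded d v) as (B & HB & Hb).
  exists (k * B + 1). split; [pose proof (Rmult_le_pos k B); lra|].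
  eapply cle_weaken; [|apply ccone_of_cone; assumption|apply (H v B); assumption]. lra.
Qed.

Lemma cle_closed (u v : vec) :
  inRd d u -> inRd d v ->
  (forall eps, 0 < eps -> exists u' v', cle u' v' /\ close d eps u' u /\ close d eps v' v) ->
  cle u v.
Proof.
  intros Hu Hv H. apply ccone_closed.
  - apply inRd_add; [assumption|apply inRd_scl; assumption].
  - intros eps He. destruct (H (eps / 2) ltac:(lra)) as (u' & v' & Hle & H1 & H2).
    eexists. split; [exact Hle|]. intros i Hi. specialize (H1 i Hi). specialize (H2 i Hi).
    unfold vadd, vscl.
    replace (v' i + -1 * u' i - (v i + -1 * u i)) with ((v' i - v i) + - (u' i - u i)) by ring.
    eapply Rle_lt_trans; [apply Rabs_triang|]. rewrite Rabs_Ropp. lra.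
Qed.

(** The closed cone is closed, so its order is Archimedean; this is how the factors [th > 1]
    disappear. *)
Lemma cle_inf (u v : vec) (b : R) :
  inRd d u -> cone Om v -> (forall th, 1 < th -> cle u (vscl (th * b) v)) -> cle u (vscl b v).
Proof.
  intros Hu Hv H. apply cle_closed; [assumption|apply inRd_scl, Hv|]. intros eps He.
  destruct (vec_bounded d (vscl b v)) as (B & HB & HbB).
  set (s := eps / (2 * (B + 1))). assert (Hs : 0 < s) by (unfold s; apply Rdiv_lt_0_compat; lra).
  exists u, (vscl ((1 + s) * b) v). split; [apply H; lra|]. split; intros i Hi.
  - rewrite Rminus_diag, Rabs_R0. assumption.
  - specialize (HbB i Hi). unfold vscl in *.
    replace ((1 + s) * b * v i - b * v i) with (s * (b * v i)) by ring.
    rewrite Rabs_mult, (Rabs_right s) by lra.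
    assert (s * (2 * (B + 1)) = eps) by (unfold s; field; lra). nra.
Qed.

Lemma cone_comb (y z : vec) (t : R) :
  cone Om y -> ccone z -> 0 <= t < 1 -> cone Om (comb t y z).
Proof.
  intros Hy [Hz1 Hz] Ht.
  assert (H : ccone (vscl t z)) by (apply ccone_scl; [lra|split; assumption]).
  replace (comb t y z) with (vadd (vscl t z) (vscl (1 - t) y)) by vec_eq.
  apply H, cone_scl; [lra|assumption].
Qed.

Lemma ccone_of_closure (z : vec) : closure d phi Om z -> ccone z.
Proof.
  intros [[Hz _] H]. apply ccone_closed; [assumption|]. intros eps He.
  destruct (H eps He) as (x & Hx & Hc). exists x. split; [|assumption].
  apply ccone_of_cone, cone_of_domain, Hx.
Qed.

(** * Boundary points on a line and the Hilbert metric *)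

Lemma inchart_comb (t : R) (x y : vec) : Om x -> Om y -> inchart d phi (comb t x y).
Proof.
  intros Hx Hy. destruct (domain_chart x Hx) as [Hx1 Hx2].
  destruct (domain_chart y Hy) as [Hy1 Hy2].
  split; [apply inRd_comb; assumption|]. rewrite lin_comb, Hx2, Hy2. ring.
Qed.

Lemma vec_neq_coord (x y : vec) : Om x -> Om y -> x <> y -> exists i, (i < d)%nat /\ x i <> y i.
Proof.
  intros Hx Hy Hn. apply NNPP. intros H. apply Hn.
  apply (inRd_ext d); [apply domain_chart, Hx|apply domain_chart, Hy|].
  intros i Hi. apply NNPP. intros Hi'. apply H. exists i. split; assumption.
Qed.

Lemma close_comb (x y : vec) (eps : R) :
  0 < eps -> exists del, 0 < del /\ forall t t', Rabs (t - t') <= del ->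
    close d eps (comb t x y) (comb t' x y).
Proof.
  intros He. destruct (vec_bounded d (vadd y (vscl (-1) x))) as (B & HB & Hb).
  set (s := eps / (2 * (B + 1))). assert (Hs : 0 < s) by (unfold s; apply Rdiv_lt_0_compat; lra).
  exists s. split; [assumption|]. intros t t' Ht i Hi. specialize (Hb i Hi).
  unfold vadd, vscl in Hb. unfold comb.
  replace ((1 - t) * x i + t * y i - ((1 - t') * x i + t' * y i)) with
    ((t - t') * (y i + -1 * x i)) by ring.
  rewrite Rabs_mult. assert (s * (2 * (B + 1)) = eps) by (unfold s; field; lra).
  pose proof (Rabs_pos (t - t')). pose proof (Rabs_pos (y i + -1 * x i)). nra.
Qed.

Lemma line_open (x y : vec) (t : R) :
  Om x -> Om y -> Om (comb t x y) -> exists s, 0 < s /\ Om (comb (t + s) x y).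
Proof.
  intros Hx Hy Ht. destruct Hdom as (_ & _ & _ & Hop & _).
  destruct (Hop _ Ht) as (eps & He & Hb). destruct (close_comb x y eps He) as (s & Hs & Hc).
  exists s. split; [assumption|]. apply Hb; [apply inchart_comb; assumption|].
  apply Hc. replace (t - (t + s)) with (- s) by ring. rewrite Rabs_Ropp, Rabs_right; lra.
Qed.

(** The exit parameter is the supremum of the parameters staying in the domain. It is finite because
    a coordinate separating [x] and [y] is bounded on the domain, and openness puts it beyond 1 and
    its point outside the domain. *)
Lemma line_exit (x y : vec) :
  Om x -> Om y -> x <> y -> exists t, 1 < t /\ boundary d phi Om (comb t x y).
Proof.
  intros Hx Hy Hn. destruct (vec_neq_coord x y Hx Hy Hn) as (i & Hi & Hxy).
  destruct Hdom as (_ & _ & _ & _ & _ & M & HM).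
  assert (H1 : Om (comb 1 x y)) by (replace (comb 1 x y) with y by vec_eq; assumption).
  destruct (completeness (fun t => Om (comb t x y))) as [t [Hub Hlub]].
  - exists (2 * M / Rabs (y i - x i)). intros s Hs.
    assert (Hp : 0 < Rabs (y i - x i)) by (apply Rabs_pos_lt; lra).
    apply Rmult_le_reg_r with (Rabs (y i - x i)); [assumption|].
    replace (2 * M / Rabs (y i - x i) * Rabs (y i - x i)) with (2 * M) by (field; lra).
    eapply Rle_trans; [apply Rle_abs|].
    rewrite Rabs_mult, Rabs_Rabsolu, <- Rabs_mult.
    replace (s * (y i - x i)) with (comb s x y i + - x i) by (unfold comb; ring).
    eapply Rle_trans; [apply Rabs_triang|]. rewrite Rabs_Ropp.
    pose proof (HM _ i Hs). pose proof (HM _ i Hx). lra.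
  - exists 1. assumption.
  - destruct (line_open x y 1 Hx Hy H1) as (s & Hs & H1s).
    assert (Ht : 1 < t) by (specialize (Hub _ H1s); lra).
    exists t. split; [assumption|]. split; [split; [apply inchart_comb; assumption|]|].
    + intros eps He. destruct (close_comb x y eps He) as (del & Hd & Hc).
      assert (Hex : exists u, Om (comb u x y) /\ t - del < u).
      { apply NNPP. intros Hno. assert (t <= t - del); [|lra]. apply Hlub. intros u Hu.
        apply Rnot_lt_le. intros Hlt. apply Hno. exists u. split; assumption. }
      destruct Hex as (u & Hu & Hlt). exists (comb u x y). split; [assumption|].
      apply Hc. specialize (Hub _ Hu). rewrite Rabs_left1; lra.
    + intros Hin. destruct (line_open x y t Hx Hy Hin) as (s' & Hs' & Hin').
      specialize (Hub _ Hin'). lra.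
Qed.

(** [Hilbert] is chosen by [epsilon], so its value satisfies [HilbertRel] only once some value
    does. *)
Lemma hilbert_exists (x y : vec) : Om x -> Om y -> exists r, HilbertRel d phi Om x y r.
Proof.
  intros Hx Hy. destruct (classic (x = y)) as [He|Hn]; [exists 0; left; auto|].
  destruct (line_exit x y Hx Hy Hn) as (tb & Htb & Hb).
  destruct (line_exit y x Hy Hx (not_eq_sym Hn)) as (ta & Hta & Ha).
  (* The exit point beyond [x] has parameter [ta] on the line read from [y] to [x], hence [1 - ta]
     here. *)
  eexists. right. split; [assumption|]. exists (1 - ta), tb.
  split; [lra|]. split; [assumption|].
  split; [|split; [assumption|reflexivity]].
  replace (comb (1 - ta) x y) with (comb ta y x) by vec_eq. assumption.
Qed.

Lemma dist_scl (u v x y : vec) (t : R) :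
  (forall i, u i - v i = t * (x i - y i)) -> dist d u v = Rabs t * dist d x y.
Proof.
  intros H. unfold dist.
  rewrite (fsum_ext d _ (fun i => Rsqr t * (x i - y i) ^ 2)).
  2:{ intros i _. rewrite H. unfold Rsqr. ring. }
  rewrite fsum_scl, sqrt_mult_alt by apply Rle_0_sqr. rewrite sqrt_Rsqr_abs. reflexivity.
Qed.

Lemma fsum_nonneg (n : nat) (f : nat -> R) : (forall i, 0 <= f i) -> 0 <= fsum n f.
Proof. intros H. induction n; simpl; [lra|specialize (H n); lra]. Qed.

Lemma fsum_pos (n i : nat) (f : nat -> R) :
  (forall j, 0 <= f j) -> (i < n)%nat -> 0 < f i -> 0 < fsum n f.
Proof.
  intros H Hi Hf. induction n; [lia|]. simpl.
  destruct (Nat.eq_dec i n) as [->|].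
  - pose proof (fsum_nonneg n f H). lra.
  - specialize (IHn ltac:(lia)). specialize (H n). lra.
Qed.

Lemma dist_pos (x y : vec) : Om x -> Om y -> x <> y -> 0 < dist d x y.
Proof.
  intros Hx Hy Hn. destruct (vec_neq_coord x y Hx Hy Hn) as (i & Hi & Hxy).
  apply sqrt_lt_R0, (fsum_pos d i); [intros; apply pow2_ge_0|assumption|].
  rewrite <- Rsqr_pow2. apply Rlt_0_sqr. lra.
Qed.

(** The coefficient is the one for which [l y - x] is a positive multiple of the exit point. *)
Lemma exit_cle (x y : vec) (t : R) :
  1 < t -> boundary d phi Om (comb t x y) -> cle x (vscl (t / (t - 1)) y).
Proof.
  intros Ht [Hc _]. unfold cle.
  replace (vadd (vscl (t / (t - 1)) y) (vscl (-1) x)) with (vscl (/ (t - 1)) (comb t x y))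
    by (vec_eq; field; lra).
  apply ccone_scl; [apply Rlt_le, Rinv_0_lt_compat; lra|]. apply ccone_of_closure, Hc.
Qed.

(** A smaller coefficient would place the exit point inside the domain. That [l > 1] comes from
    [phi], which takes the value [l - 1] on [l y - x]; if [l = 1], pointedness would force
    [x = y]. *)
Lemma exit_cle_sharp (x y : vec) (t l : R) :
  Om x -> Om y -> x <> y -> 1 < t -> boundary d phi Om (comb t x y) ->
  cle x (vscl l y) -> t / (t - 1) <= l.
Proof.
  intros Hx Hy Hn Ht [_ Hb] Hl.
  destruct (domain_chart x Hx) as [_ Hx2]. destruct (domain_chart y Hy) as [_ Hy2].
  assert (Hlin := ccone_lin _ Hl). rewrite lin_add, !lin_scl, Hx2, Hy2 in Hlin.
  assert (Hl1 : 1 < l).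
  { destruct (Req_dec l 1) as [->|]; [|lra]. exfalso. apply Hn.
    apply ccone_lin0 in Hl; [|rewrite lin_add, !lin_scl, Hx2, Hy2; ring].
    extensionality i. apply (f_equal (fun v => v i)) in Hl.
    unfold vadd, vscl, vzero in Hl. lra. }
  apply Rnot_lt_le. intros Hlt.
  assert (Hlt' : l * (t - 1) < t).
  { apply (Rmult_lt_compat_r (t - 1)) in Hlt; [|lra]. unfold Rdiv in Hlt.
    rewrite Rmult_assoc, Rinv_l in Hlt by lra. lra. }
  apply Hb. apply domain_of_cone; [|apply (inchart_comb t x y); assumption].
  (* [comb t x y] lies strictly between [y] and the point of the closed cone given by [l]. *)
  replace (comb t x y) with
    (comb ((t - 1) * (l - 1)) y (vscl (/ (l - 1)) (vadd (vscl l y) (vscl (-1) x))))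
    by (vec_eq; field; lra).
  apply cone_comb; [apply cone_of_domain; assumption| |split; nra].
  apply ccone_scl; [apply Rlt_le, Rinv_0_lt_compat; lra|assumption].
Qed.

(* Birkhoff's expression of the Hilbert metric by the order of the cone. *)
Lemma hilbert_le_iff (x y : vec) (r : R) :
  Om x -> Om y ->
  (Hilbert d phi Om x y <= r <->
   exists l m, 0 < l /\ 0 < m /\ cle x (vscl l y) /\ cle y (vscl m x) /\ l * m <= exp (2 * r)).
Proof.
  intros Hx Hy.
  assert (HR : HilbertRel d phi Om x y (Hilbert d phi Om x y)).
  { unfold Hilbert. apply epsilon_spec, hilbert_exists; assumption. }
  destruct HR as [[He ->]|(Hn & ta & tb & Hta & Htb & Ha & Hb & ->)].
  - subst y. split.
    + intros Hr. exists 1, 1.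
      assert (cle x (vscl 1 x)) by (replace (vscl 1 x) with x by vec_eq; apply cle_refl).
      do 2 (split; [lra|]). do 2 (split; [assumption|]). rewrite Rmult_1_l, <- exp_0.
      destruct Hr as [Hr| <-]; [left; apply exp_increasing; lra|right; f_equal; ring].
    + intros (l & m & Hl & Hm & H1 & H2 & H3). apply Rnot_lt_le. intros Hr.
      assert (Hs : forall k, cle x (vscl k x) -> 1 <= k).
      { intros k Hk. apply (cle_scl_le _ _ x); [apply cone_of_domain; assumption|].
        replace (vscl 1 x) with x by vec_eq. assumption. }
      apply Hs in H1. apply Hs in H2.
      assert (exp (2 * r) < 1) by (rewrite <- exp_0; apply exp_increasing; lra). nra.
  - assert (Hd := dist_pos x y Hx Hy Hn).
    rewrite (dist_scl x (comb tb x y) x y tb) by (intros; unfold comb; ring).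
    rewrite (dist_scl y (comb tb x y) x y (tb - 1)) by (intros; unfold comb; ring).
    rewrite (dist_scl x (comb ta x y) x y ta) by (intros; unfold comb; ring).
    rewrite (dist_scl y (comb ta x y) x y (ta - 1)) by (intros; unfold comb; ring).
    rewrite (Rabs_right tb), (Rabs_right (tb - 1)), (Rabs_left ta), (Rabs_left (ta - 1)) by lra.
    (* The cross-ratio splits into the optimal coefficients of the two inequalities; the second
       factor is the first one with [x] and [y] exchanged and exit parameter [1 - ta]. *)
    replace (tb * dist d x y * (- (ta - 1) * dist d x y) /
             (- ta * dist d x y * ((tb - 1) * dist d x y)))
      with (tb / (tb - 1) * ((1 - ta) / (1 - ta - 1))) by (field; lra).
    replace (comb ta x y) with (comb (1 - ta) y x) in Ha by vec_eq.
    set (l0 := tb / (tb - 1)). set (m0 := (1 - ta) / (1 - ta - 1)).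
    assert (Hl0 : 0 < l0) by (apply Rdiv_lt_0_compat; lra).
    assert (Hm0 : 0 < m0) by (apply Rdiv_lt_0_compat; lra).
    assert (Hlm : 0 < l0 * m0) by (apply Rmult_lt_0_compat; assumption).
    split.
    + intros Hr. exists l0, m0. repeat (split; [assumption|]).
      split; [apply exit_cle; assumption|]. split; [apply exit_cle; [lra|assumption]|].
      rewrite <- (exp_ln (l0 * m0)) by assumption.
      destruct (Rle_lt_or_eq_dec _ _ Hr) as [Hlt|Heq].
      * left. apply exp_increasing. lra.
      * right. f_equal. lra.
    + intros (l & m & Hl & Hm & H1 & H2 & H3).
      assert (l0 <= l) by (apply (exit_cle_sharp x y); assumption).
      assert (m0 <= m) by (apply (exit_cle_sharp y x); auto; lra).
      assert (Hle : l0 * m0 <= exp (2 * r)).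
      { eapply Rle_trans; [|exact H3]. apply Rmult_le_compat; lra. }
      assert (ln (l0 * m0) <= 2 * r).
      { rewrite <- (ln_exp (2 * r)). destruct Hle as [Hlt|Heq].
        - left. apply ln_increasing; assumption.
        - right. rewrite Heq. reflexivity. }
      lra.
Qed.

(** * Linear maps preserving the cone *)

Definition cone_map (g : mat) : Prop := forall v, cone Om v -> cone Om (mv d g v).

Lemma ccone_mv (g : mat) (v : vec) : cone_map g -> ccone v -> ccone (mv d g v).
Proof.
  intros Hg [Hv1 Hv2]. apply ccone_closed; [apply mv_inRd|]. intros eps He.
  destruct domain_inhabited as [x Hx]. apply cone_of_domain in Hx.
  destruct (vec_bounded d (mv d g x)) as (B & HB & Hb).
  set (s := eps / (2 * (B + 1))). assert (Hs : 0 < s) by (unfold s; apply Rdiv_lt_0_compat; lra).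
  exists (mv d g (vadd v (vscl s x))). split.
  - apply ccone_of_cone, Hg, Hv2, cone_scl; assumption.
  - intros i Hi. specialize (Hb i Hi). rewrite mv_add, mv_scl. unfold vadd, vscl.
    replace (mv d g v i + s * mv d g x i - mv d g v i) with (s * mv d g x i) by ring.
    rewrite Rabs_mult, (Rabs_right s) by lra.
    assert (s * (2 * (B + 1)) = eps) by (unfold s; field; lra). nra.
Qed.

Lemma cle_mv (g : mat) (u v : vec) : cone_map g -> cle u v -> cle (mv d g u) (mv d g v).
Proof.
  intros Hg H. unfold cle. rewrite <- mv_scl, <- mv_add. apply ccone_mv; assumption.
Qed.

Lemma cle_iterv (g : mat) (n : nat) (u v : vec) :
  cone_map g -> cle u v -> cle (iterv d g n u) (iterv d g n v).
Proof. intros Hg H. induction n; [assumption|]. rewrite !iterv_S. apply cle_mv; assumption. Qed.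

Lemma cone_iterv (g : mat) (n : nat) (v : vec) :
  cone_map g -> cone Om v -> cone Om (iterv d g n v).
Proof. intros Hg Hv. induction n; [assumption|]. rewrite iterv_S. auto. Qed.

Lemma iterv_scl (g : mat) (n : nat) (c : R) (v : vec) :
  iterv d g n (vscl c v) = vscl c (iterv d g n v).
Proof. induction n; [reflexivity|]. rewrite !iterv_S, IHn. apply mv_scl. Qed.

Lemma cle_iterv_upper (g : mat) (n : nat) (b : R) (y : vec) :
  cone_map g -> 0 < b -> cle (mv d g y) (vscl b y) -> cle (iterv d g n y) (vscl (b ^ n) y).
Proof.
  intros Hg Hb H. induction n.
  - replace (vscl (b ^ 0) y) with y by (vec_eq; simpl; ring). apply cle_refl.
  - rewrite iterv_S. apply (cle_mv g) in IHn; [|assumption]. rewrite mv_scl in IHn.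
    replace (b ^ S n) with (b ^ n * b) by (simpl; ring).
    apply (cle_scl_chain _ (mv d g y)); [apply pow_le; lra|assumption|assumption].
Qed.

Lemma cle_iterv_lower (g : mat) (n : nat) (a : R) (y : vec) :
  cone_map g -> 0 < a -> cle (vscl a y) (mv d g y) -> cle (vscl (a ^ n) y) (iterv d g n y).
Proof.
  intros Hg Ha H. induction n.
  - replace (vscl (a ^ 0) y) with y by (vec_eq; simpl; ring). apply cle_refl.
  - rewrite iterv_S. apply (cle_mv g) in IHn; [|assumption]. rewrite mv_scl in IHn.
    eapply cle_trans; [|exact IHn].
    replace (vscl (a ^ S n) y) with (vscl (a ^ n) (vscl a y)) by (vec_eq; simpl; ring).
    apply cle_scl; [apply pow_le; lra|assumption].
Qed.

(* Half of the Collatz-Wielandt formula. *)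
Lemma spectral_compare (g : mat) (x y : vec) (a b : R) :
  cone_map g -> cone Om x -> cone Om y -> 0 < a -> 0 < b ->
  cle (mv d g x) (vscl b x) -> cle (vscl a y) (mv d g y) -> a <= b.
Proof.
  intros Hg Hx Hy Ha Hb H1 H2.
  destruct (cle_unit y x Hx (cone_inRd _ _ Hy)) as (k & Hk & Hyx).
  destruct (cle_unit x y Hy (cone_inRd _ _ Hx)) as (k' & Hk' & Hxy).
  apply (pow_growth_le a b (k * k')); [assumption|assumption|]. intros n.
  apply (cle_scl_le _ _ y Hy).
  eapply cle_trans; [apply cle_iterv_lower; eassumption|].
  replace (k * k' * b ^ n) with (k * (b ^ n * k')) by ring.
  apply (cle_scl_chain _ (iterv d g n x)); [lra| |].
  - rewrite <- iterv_scl. apply cle_iterv; assumption.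
  - eapply cle_scl_chain; [apply pow_le; lra|apply cle_iterv_upper; eassumption|assumption].
Qed.

(** From [a b = c b a] follows [a b^n = c^n b^n a]. Hence [a] stretches [b^n x] by at least
    [c^n / k'], while it stretches [x] by at most [k]; comparing the two bounds the powers of [c] by
    [k * k']. *)
Lemma scalar_commutator_le (a b : mat) (c : R) :
  cone_map a -> cone_map b -> 0 < c ->
  (forall v, inRd d v -> mv d a (mv d b v) = vscl c (mv d b (mv d a v))) -> c <= 1.
Proof.
  intros Ha Hb Hc H. destruct domain_inhabited as [x Hx]. apply cone_of_domain in Hx.
  destruct (cle_unit (mv d a x) x Hx (mv_inRd _ _ _)) as (k & Hk & Hax).
  destruct (cle_unit x (mv d a x) (Ha x Hx) (cone_inRd _ _ Hx)) as (k' & Hk' & Hxa).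
  assert (Hn : forall n, mv d a (iterv d b n x) = vscl (c ^ n) (iterv d b n (mv d a x))).
  { induction n.
    - replace (vscl (c ^ 0) (iterv d b 0 (mv d a x))) with (iterv d b 0 (mv d a x))
        by (vec_eq; simpl; ring). reflexivity.
    - rewrite !iterv_S, H, IHn, mv_scl by (apply iterv_inRd, Hx). vec_eq. simpl. ring. }
  apply (pow_growth_le c 1 (k * k')); [assumption|lra|]. intros n. rewrite pow1, Rmult_1_r.
  assert (Hcn : 0 < c ^ n) by (apply pow_lt; assumption).
  assert (Hle : / k' * c ^ n <= k).
  { apply (spectral_compare a x (iterv d b n x)); try assumption.
    - apply cone_iterv; assumption.
    - apply Rmult_lt_0_compat; [apply Rinv_0_lt_compat|]; assumption.
    - rewrite Hn. apply (cle_iterv b n) in Hxa; [|assumption]. rewrite iterv_scl in Hxa.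
      apply (cle_scl (/ k' * c ^ n)) in Hxa;
        [|apply Rmult_le_pos; [apply Rlt_le, Rinv_0_lt_compat|]; lra].
      replace (vscl (c ^ n) (iterv d b n (mv d a x))) with
        (vscl (/ k' * c ^ n) (vscl k' (iterv d b n (mv d a x)))) by (vec_eq; field; lra).
      assumption. }
  apply (Rmult_le_compat_l k') in Hle; [|lra].
  rewrite <- Rmult_assoc, Rinv_r in Hle by lra. lra.
Qed.

(** The bound applies to [c] and, with the two maps exchanged, to its inverse. This turns
    commutation in PGL into commutation of linear maps. *)
Lemma scalar_commutator_one (a b : mat) (c : R) :
  cone_map a -> cone_map b ->
  (forall v, inRd d v -> mv d a (mv d b v) = vscl c (mv d b (mv d a v))) -> c = 1.
Proof.
  intros Ha Hb H. destruct domain_inhabited as [x Hx]. apply cone_of_domain in Hx.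
  assert (Hc : 0 < c).
  { destruct (Ha _ (Hb _ Hx)) as (_ & H1 & _). destruct (Hb _ (Ha _ Hx)) as (_ & H2 & _).
    rewrite H, lin_scl in H1 by apply Hx. nra. }
  assert (Hc1 : c <= 1) by (apply (scalar_commutator_le a b); assumption).
  assert (Hc2 : / c <= 1).
  { apply (scalar_commutator_le b a); try assumption; [apply Rinv_0_lt_compat; assumption|].
    intros v Hv. rewrite H by assumption. vec_eq. field. lra. }
  apply (Rmult_le_compat_l c) in Hc2; [|lra]. rewrite Rinv_r in Hc2; lra.
Qed.

(** Minimality of the least [b] with [g x <= b x], up to the factor [th], stated without naming the
    infimum. Competitors range over the cone of the whole domain even when [x] is sought over [C];
    [th = 1] is exact minimality. *)
Definition near_min (th : R) (g : mat) (x : vec) : Prop :=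
  forall y b, cone Om y -> 0 < b -> cle (mv d g y) (vscl b y) ->
    cle (mv d g x) (vscl (th * b) x).

(** The infimum of the admissible [b] is positive, since a lower bound [x <= k' g x] at one point
    gives [/ k' <= b] at every point. Reciprocals convert it into a supremum. *)
Lemma near_optimal_bound (g : mat) (th : R) :
  cone_map g -> 1 < th ->
  exists y b, cone Om y /\ 0 < b /\ cle (mv d g y) (vscl b y) /\
    forall y' b', cone Om y' -> 0 < b' -> cle (mv d g y') (vscl b' y') -> b <= th * b'.
Proof.
  intros Hg Hth. destruct domain_inhabited as [x Hx]. apply cone_of_domain in Hx.
  destruct (cle_unit (mv d g x) x Hx (mv_inRd _ _ _)) as (k & Hk & Hgx).
  destruct (cle_unit x (mv d g x) (Hg x Hx) (cone_inRd _ _ Hx)) as (k' & Hk' & Hxg).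
  destruct (completeness (fun r => exists y b, r = / b /\ cone Om y /\ 0 < b /\
                                     cle (mv d g y) (vscl b y))) as [m [Hub Hlub]].
  - exists k'. intros r (y & b & -> & Hy & Hb & H).
    rewrite <- (Rinv_inv k'). apply Rinv_le_contravar; [apply Rinv_0_lt_compat; assumption|].
    apply (spectral_compare g y x); try assumption; [apply Rinv_0_lt_compat; assumption|].
    apply (cle_scl (/ k')) in Hxg; [|apply Rlt_le, Rinv_0_lt_compat; assumption].
    replace (mv d g x) with (vscl (/ k') (vscl k' (mv d g x))) by (vec_eq; field; lra).
    assumption.
  - exists (/ k), x, k. auto.
  - assert (Hm : 0 < m).
    { assert (/ k <= m) by (apply Hub; exists x, k; auto).
      assert (0 < / k) by (apply Rinv_0_lt_compat; assumption). lra. }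
    assert (Hex : exists y b, cone Om y /\ 0 < b /\ cle (mv d g y) (vscl b y) /\ m / th < / b).
    { apply NNPP. intros Hno. assert (m <= m / th).
      - apply Hlub. intros r (y & b & -> & Hy & Hb & H). apply Rnot_lt_le. intros Hlt.
        apply Hno. exists y, b. auto.
      - apply (Rmult_le_compat_r th) in H; [|lra].
        replace (m / th * th) with m in H by (field; lra). nra. }
    destruct Hex as (y & b & Hy & Hb & H & Hlt). exists y, b.
    do 3 (split; [assumption|]). intros y' b' Hy' Hb' H'.
    assert (Hm' : / b' <= m) by (apply Hub; exists y', b'; auto).
    apply (Rmult_lt_compat_r (b * th)) in Hlt; [|apply Rmult_lt_0_compat; lra].
    replace (m / th * (b * th)) with (m * b) in Hlt by (field; lra).
    replace (/ b * (b * th)) with th in Hlt by (field; lra).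
    apply (Rmult_le_compat_r (b' * b)) in Hm'; [|apply Rlt_le, Rmult_lt_0_compat; lra].
    replace (/ b' * (b' * b)) with b in Hm' by (field; lra). nra.
Qed.

(* [sum_(i < n) b^-i g^i v]: a truncated Neumann series of the resolvent of [g]. *)
Fixpoint orbit_sum (g : mat) (b : R) (n : nat) (v : vec) : vec :=
  match n with
  | 0%nat => vzero
  | S m => vadd (orbit_sum g b m v) (vscl (/ b ^ m) (iterv d g m v))
  end.

(** Applying [b^-1 g] shifts the series, so only the new last term and the lost first term survive.
    Thus [g S <= b S] reduces to [g^n v <= b^n v]. *)
Lemma orbit_sum_telescope (g : mat) (b : R) (n : nat) (v : vec) :
  0 < b -> mv d g (orbit_sum g b n v) =
    vscl b (vadd (orbit_sum g b n v) (vadd (vscl (/ b ^ n) (iterv d g n v)) (vscl (-1) v))).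
Proof.
  intros Hb. induction n.
  - apply (inRd_ext d); [apply mv_inRd| |].
    + intros i Hi. unfold vscl, vadd, iterv. simpl. unfold vzero. field.
    + intros i Hi. rewrite mv_lt by assumption. simpl.
      rewrite (fsum_ext _ _ (fun _ => 0)), fsum_zero by (intros; unfold vzero; ring).
      unfold vscl, vadd, vzero, iterv. simpl. field.
  - simpl orbit_sum. rewrite mv_add, mv_scl, IHn, <- iterv_S. vec_eq. simpl.
    assert (b ^ n <> 0) by (apply pow_nonzero; lra). field. lra.
Qed.

Lemma orbit_sum_cone (X : vec -> Prop) (g : mat) (b : R) (n : nat) (v : vec) :
  convex X -> (forall w, cone X w -> cone X (mv d g w)) -> 0 < b -> cone X v ->
  (1 <= n)%nat -> cone X (orbit_sum g b n v).
Proof.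
  intros HX Hg Hb Hv Hn.
  assert (Hi : forall m, cone X (vscl (/ b ^ m) (iterv d g m v))).
  { intros m. apply cone_scl; [apply Rinv_0_lt_compat, pow_lt, Hb|].
    induction m; [assumption|]. rewrite iterv_S. auto. }
  destruct n as [|n]; [lia|]. clear Hn. induction n.
  - replace (orbit_sum g b 1 v) with (vscl (/ b ^ 0) (iterv d g 0 v)); [apply Hi|].
    extensionality j. simpl. unfold vadd, vscl, vzero. ring.
  - change (orbit_sum g b (S (S n)) v) with
      (vadd (orbit_sum g b (S n) v) (vscl (/ b ^ S n) (iterv d g (S n) v))).
    apply cone_add; auto.
Qed.

Lemma orbit_sum_cle (g : mat) (b : R) (n : nat) (u v : vec) :
  cone_map g -> 0 < b -> cle u v -> cle (orbit_sum g b n u) (orbit_sum g b n v).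
Proof.
  intros Hg Hb H. induction n; [apply cle_refl|]. simpl. apply cle_add; [assumption|].
  apply cle_scl; [apply Rlt_le, Rinv_0_lt_compat, pow_lt, Hb|apply cle_iterv; assumption].
Qed.

Lemma orbit_sum_scl (g : mat) (b c : R) (n : nat) (v : vec) :
  orbit_sum g b n (vscl c v) = vscl c (orbit_sum g b n v).
Proof. induction n; simpl; [vec_eq|]. rewrite IHn, iterv_scl. vec_eq. Qed.

Lemma orbit_sum_comm (g h : mat) (b : R) (n : nat) (v : vec) :
  mcommute d g h -> inRd d v ->
  mv d h (orbit_sum g b n v) = orbit_sum g b n (mv d h v).
Proof.
  intros H Hv.
  assert (Hi : forall m, mv d h (iterv d g m v) = iterv d g m (mv d h v)).
  { induction m; [reflexivity|].
    rewrite !iterv_S, <- IHm, H by (apply iterv_inRd, Hv). reflexivity. }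
  induction n; simpl.
  - apply (inRd_ext d); [apply mv_inRd|intros i _; reflexivity|]. intros i Hi'.
    rewrite mv_lt by assumption.
    rewrite (fsum_ext _ _ (fun _ => 0)), fsum_zero by (intros; unfold vzero; ring). reflexivity.
  - rewrite mv_add, mv_scl, IHn, Hi. reflexivity.
Qed.

Lemma near_min_orbit_sum (g h : mat) (b th : R) (n : nat) (x : vec) :
  cone_map g -> 0 < b -> inRd d x ->
  mcommute d g h ->
  near_min th h x -> near_min th h (orbit_sum g b n x).
Proof.
  intros Hg Hb Hx Hc Hm y c Hy Hc0 H. rewrite orbit_sum_comm, <- orbit_sum_scl by assumption.
  apply orbit_sum_cle; [assumption|assumption|]. apply (Hm y); assumption.
Qed.

(** If [b] is nearly optimal at some [y], comparing [x] with [y] gives [g^n x <= k * k' * b^n x] for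
    any prescribed [x]. A slightly larger base absorbs the constant once [n] is large, and the
    telescoped series then satisfies the inequality with that base. *)
Lemma orbit_sum_near_min (g : mat) (th : R) (x : vec) :
  cone_map g -> 1 < th -> cone Om x ->
  exists n b, (1 <= n)%nat /\ 0 < b /\ near_min th g (orbit_sum g b n x).
Proof.
  intros Hg Hth Hx.
  (* The factor [th = q * t1] is shared: [t1] pays for near-optimality of [b], and the powers of [q]
     absorb [k * k']. *)
  set (t1 := (1 + th) / 2). assert (Ht1 : 1 < t1 < th) by (unfold t1; lra).
  destruct (near_optimal_bound g t1 Hg (proj1 Ht1)) as (y & b & Hy & Hb & Hgy & Hopt).
  set (q := th / t1).
  assert (Hq : 1 < q).
  { unfold q. apply Rmult_lt_reg_r with t1; [lra|]. unfold Rdiv.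
    rewrite Rmult_assoc, Rinv_l; lra. }
  assert (Hqt : q * t1 = th) by (unfold q; field; lra).
  destruct (cle_unit x y Hy (cone_inRd _ _ Hx)) as (k & Hk & Hxy).
  destruct (cle_unit y x Hx (cone_inRd _ _ Hy)) as (k' & Hk' & Hyx).
  destruct (pow_ratio_unbounded q (k * k') Hq) as (n & Hn & Hqn).
  set (c := q * b). assert (Hc : 0 < c) by (unfold c; nra).
  exists n, c. split; [assumption|]. split; [assumption|].
  assert (Hpow : cle (iterv d g n x) (vscl (c ^ n) x)).
  { apply cle_weaken with (k * (b ^ n * k')).
    - unfold c. rewrite Rpow_mult_distr. assert (0 < b ^ n) by (apply pow_lt; lra). nra.
    - apply ccone_of_cone; assumption.
    - apply (cle_scl_chain _ (iterv d g n y)); [lra| |].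
      + rewrite <- iterv_scl. apply cle_iterv; assumption.
      + eapply cle_scl_chain; [apply pow_le; lra|apply cle_iterv_upper; eassumption|assumption]. }
  intros z e Hz He Hgz. specialize (Hopt z e Hz He Hgz).
  apply cle_weaken with c.
  - unfold c. rewrite <- Hqt. nra.
  - apply ccone_of_cone. apply orbit_sum_cone; auto using domain_convex.
  - rewrite orbit_sum_telescope by assumption. apply cle_scl; [lra|]. unfold cle.
    set (S := orbit_sum g c n x).
    replace (vadd S (vscl (-1) (vadd S (vadd (vscl (/ c ^ n) (iterv d g n x)) (vscl (-1) x)))))
      with (vscl (/ c ^ n) (vadd (vscl (c ^ n) x) (vscl (-1) (iterv d g n x))))
      by (vec_eq; field; apply pow_nonzero; lra).
    apply ccone_scl; [apply Rlt_le, Rinv_0_lt_compat, pow_lt, Hc|assumption].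
Qed.

(** [X] will be [C] when minimizers are sought, and the domain itself when the displacement is split
    into its two factors. Since [near_min] refers to the whole domain, nothing is lost by staying
    over [X]. *)
Lemma simultaneous_near_min (X : vec -> Prop) (l : list mat) (th : R) :
  convex X -> (exists x, X x) -> (forall x, X x -> Om x) -> 1 < th ->
  (forall g, In g l -> cone_map g /\ forall w, cone X w -> cone X (mv d g w)) ->
  (forall g h, In g l -> In h l -> mcommute d g h) ->
  exists x, cone X x /\ forall g, In g l -> near_min th g x.
Proof.
  intros HX [x0 Hx0] HXO Hth. induction l as [|g l IH]; intros Hg Hc.
  - exists x0. split; [apply cone_of_set; assumption|intros g []].
  - destruct IH as (x & Hx & Hm); [intros; apply Hg; right; assumption| |].
    { intros; apply Hc; try right; assumption. }
    destruct (Hg g (or_introl eq_refl)) as [Hg1 Hg2].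
    assert (HxO : cone Om x) by (destruct Hx as (? & ? & ?); repeat split; auto).
    destruct (orbit_sum_near_min g th x Hg1 Hth HxO) as (n & b & Hn & Hb & Hmin).
    exists (orbit_sum g b n x). split; [apply orbit_sum_cone; assumption|].
    intros h [<-|Hh]; [assumption|].
    apply near_min_orbit_sum; auto; [apply Hx|]. intros w Hw.
    apply Hc; [left; reflexivity|right; assumption|assumption].
Qed.

Lemma near_min_scl (th c : R) (g : mat) (x : vec) :
  0 < c -> near_min th g x -> near_min th g (vscl c x).
Proof.
  intros Hc Hm y b Hy Hb H. rewrite mv_scl.
  replace (vscl (th * b) (vscl c x)) with (vscl c (vscl (th * b) x)) by vec_eq.
  apply cle_scl; [lra|]. apply (Hm y); assumption.
Qed.

Lemma near_min_normalize (th : R) (g : mat) (x : vec) :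
  cone Om x -> near_min th g x -> near_min th g (vnormalize x).
Proof. intros (_ & Hl & _). apply near_min_scl, Rinv_0_lt_compat, Hl. Qed.

Lemma near_min_comm (th : R) (g h : mat) (x : vec) :
  cone_map h -> inRd d x -> mcommute d h g ->
  near_min th g x -> near_min th g (mv d h x).
Proof.
  intros Hh Hx Hc Hm y b Hy Hb H. rewrite <- Hc, <- mv_scl by assumption.
  apply cle_mv; [assumption|]. apply (Hm y); assumption.
Qed.

Lemma near_min_proj (th c : R) (g h : mat) (x : vec) :
  0 < c -> (forall v, mv d g v = vscl c (mv d h v)) -> near_min th h x -> near_min th g x.
Proof.
  intros Hc Hgh Hm y b Hy Hb H. rewrite Hgh in *.
  replace (vscl (th * b) x) with (vscl c (vscl (th * (b / c)) x)) by (vec_eq; field; lra).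
  apply cle_scl; [lra|]. apply (Hm y); [assumption|apply Rdiv_lt_0_compat; assumption|].
  apply (cle_unscl c); [assumption|].
  replace (vscl c (vscl (b / c) y)) with (vscl b y) by (vec_eq; field; lra). assumption.
Qed.

Lemma near_min_comb (g : mat) (x y : vec) (t : R) :
  0 <= t <= 1 -> near_min 1 g x -> near_min 1 g y -> near_min 1 g (comb t x y).
Proof.
  intros Ht Hx Hy z b Hz Hb H.
  change (comb t x y) with (vadd (vscl (1 - t) x) (vscl t y)). rewrite mv_add, !mv_scl.
  replace (vscl (1 * b) (vadd (vscl (1 - t) x) (vscl t y))) with
    (vadd (vscl (1 - t) (vscl (1 * b) x)) (vscl t (vscl (1 * b) y))) by vec_eq.
  apply cle_add; (apply cle_scl; [lra|]); [apply (Hx z)|apply (Hy z)]; assumption.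
Qed.

(** * Automorphisms and their displacement *)

Lemma pact_normalize (g : mat) (x : vec) : pact d phi g x = vnormalize (mv d g x).
Proof. extensionality i. unfold pact, vnormalize, vscl, Rdiv. ring. Qed.

Definition mscl (c : R) (g : mat) : mat := fun i j => c * g i j.

Lemma mv_mscl (c : R) (g : mat) (v : vec) : mv d (mscl c g) v = vscl c (mv d g v).
Proof. apply mv_proj. reflexivity. Qed.

(** If the signs differed, the affine function [phi o g] would vanish at a point of the segment, at
    parameter [a / (a - b)], and the image of this point of the domain would leave the chart. *)
Lemma aut_sign (g : mat) (x y : vec) :
  Aut d phi Om g -> Om x -> Om y -> 0 < lin d phi (mv d g x) -> 0 < lin d phi (mv d g y).
Proof.
  intros (_ & H & _) Hx Hy Hgx. set (a := lin d phi (mv d g x)) in *.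
  set (b := lin d phi (mv d g y)). apply Rnot_le_lt. intros Hb.
  set (t := a / (a - b)).
  assert (Ht : 0 <= t <= 1).
  { split; [apply Rlt_le, Rdiv_lt_0_compat; lra|].
    apply Rmult_le_reg_r with (a - b); [lra|]. unfold t, Rdiv.
    rewrite Rmult_assoc, Rinv_l; lra. }
  destruct (H (comb t x y)) as [Hne _]; [apply domain_convex; assumption|]. apply Hne.
  change (comb t x y) with (vadd (vscl (1 - t) x) (vscl t y)).
  rewrite mv_add, !mv_scl, lin_add, !lin_scl. fold a b. unfold t. field. lra.
Qed.

Lemma cone_map_of_pos (X : vec -> Prop) (g : mat) :
  (forall x, X x -> 0 < lin d phi (mv d g x)) ->
  (forall x, X x -> X (pact d phi g x)) ->
  forall v, cone X v -> cone X (mv d g v).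
Proof.
  intros H1 H2 v (Hv1 & Hv2 & Hv3).
  assert (Hv : v = vscl (lin d phi v) (vnormalize v)).
  { unfold vnormalize. vec_eq. field. lra. }
  rewrite Hv, mv_scl. apply cone_scl; [assumption|].
  split; [apply mv_inRd|]. split; [apply H1; assumption|].
  rewrite <- pact_normalize. apply H2, Hv3.
Qed.

Lemma aut_cone_lift (g : mat) :
  Aut d phi Om g -> exists c, c <> 0 /\ cone_map (mscl c g).
Proof.
  intros Hg. destruct domain_inhabited as [x0 Hx0]. assert (Hg' := Hg).
  destruct Hg as (_ & Hg & _).
  destruct (Rlt_le_dec 0 (lin d phi (mv d g x0))) as [Hp|Hn].
  - exists 1. split; [lra|]. refine (cone_map_of_pos Om _ _ _).
    + intros x Hx. rewrite mv_mscl, lin_scl, Rmult_1_l. apply (aut_sign g x0); assumption.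
    + intros x Hx. rewrite pact_normalize, mv_mscl, vnormalize_scl;
        [rewrite <- pact_normalize; apply Hg, Hx|lra|apply Hg, Hx].
  - exists (-1). split; [lra|]. refine (cone_map_of_pos Om _ _ _).
    + intros x Hx. rewrite mv_mscl, lin_scl.
      destruct (Hg x Hx) as [Hne _].
      destruct (Rlt_le_dec 0 (lin d phi (mv d g x))) as [Hp|]; [|lra].
      apply (aut_sign g x x0) in Hp; try assumption. lra.
    + intros x Hx. rewrite pact_normalize, mv_mscl, vnormalize_scl;
        [rewrite <- pact_normalize; apply Hg, Hx|lra|apply Hg, Hx].
Qed.

(** A subgroup of PGL is stored as a union of scalar classes; these are the representatives
    preserving the cone. Every class contains one. *)
Definition pos (G : mat -> Prop) (g : mat) : Prop := G g /\ cone_map g.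

Lemma pos_lift (G : mat -> Prop) (g : mat) :
  PGL_subgroup d G -> (forall h, G h -> Aut d phi Om h) -> G g ->
  exists c, c <> 0 /\ pos G (mscl c g).
Proof.
  intros (_ & Hcl & _) HA Hg. destruct (aut_cone_lift g (HA g Hg)) as (c & Hc & Hm).
  exists c. split; [assumption|]. split; [|assumption].
  apply (Hcl g); [assumption|]. exists c. split; [assumption|]. reflexivity.
Qed.

Lemma pos_inverse (G : mat -> Prop) (g : mat) :
  PGL_subgroup d G -> (forall h, G h -> Aut d phi Om h) -> pos G g ->
  exists h, pos G h /\ inv_pair d g h.
Proof.
  intros HG HA [Hg Hpg]. assert (HG' := HG). destruct HG' as (_ & _ & _ & _ & Hinv).
  (* [h] is known only as a left inverse; a left inverse [k] of [h] makes it two-sided. *)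
  destruct (Hinv g Hg) as (h & Hh & Hhg). destruct (Hinv h Hh) as (k & Hk & Hkh).
  assert (H1 : forall v, inRd d v -> mv d h (mv d g v) = v).
  { intros v Hv. rewrite <- mv_mmul, (mv_ext d _ mid v Hhg). apply mv_mid, Hv. }
  assert (H2 : forall v, inRd d v -> mv d k (mv d h v) = v).
  { intros v Hv. rewrite <- mv_mmul, (mv_ext d _ mid v Hkh). apply mv_mid, Hv. }
  assert (H3 : inv_pair d g h).
  { split; [assumption|]. intros v Hv.
    rewrite <- (H2 (mv d g (mv d h v))), H1 by apply mv_inRd. auto. }
  exists h. split; [|assumption]. split; [assumption|].
  destruct domain_inhabited as [x Hx]. assert (Hcx := cone_of_domain x Hx).
  destruct (Hpg x Hcx) as (_ & _ & Hgx).
  (* One point fixes the sign of [h]: the normalized image of [x] under [g] is sent back to a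
     positive multiple of [x]. *)
  assert (Hhp : forall y, Om y -> 0 < lin d phi (mv d h y)).
  { intros y Hy. apply (aut_sign h (vnormalize (mv d g x))); auto.
    unfold vnormalize. rewrite mv_scl, H1, lin_scl by apply Hcx.
    apply Rmult_lt_0_compat; [|apply Hcx]. apply Rinv_0_lt_compat, Hpg, Hcx. }
  refine (cone_map_of_pos Om _ _ _); [assumption|]. intros y Hy. apply (HA h Hh), Hy.
Qed.

(** Applying the inverse turns [x <= l g x] into [h x <= l x]. The normalizing factor [s] enters the
    two constants inversely and cancels from their product. *)
Lemma displacement_le_iff (g h : mat) (x : vec) (r : R) :
  cone_map g -> cone_map h -> inv_pair d g h -> Om x ->
  (Hilbert d phi Om x (pact d phi g x) <= r <->
   exists l m, 0 < l /\ 0 < m /\ cle (mv d g x) (vscl l x) /\ cle (mv d h x) (vscl m x) /\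
     l * m <= exp (2 * r)).
Proof.
  intros Hg Hh [Hgh Hhg] Hx. assert (Hcx := cone_of_domain x Hx).
  assert (Hgx := Hg x Hcx). rewrite pact_normalize, hilbert_le_iff by (assumption || apply Hgx).
  unfold vnormalize. set (s := lin d phi (mv d g x)).
  assert (Hs : 0 < s) by apply Hgx. assert (Hs' : 0 < / s) by (apply Rinv_0_lt_compat, Hs).
  split; intros (l & m & Hl & Hm & H1 & H2 & H3).
  - exists (s * m), (l / s).
    split; [nra|]. split; [apply Rdiv_lt_0_compat; assumption|]. split; [|split].
    + apply (cle_unscl (/ s)); [assumption|].
      replace (vscl (/ s) (vscl (s * m) x)) with (vscl m x) by (vec_eq; field; lra). assumption.
    + apply (cle_mv h) in H1; [|assumption]. rewrite !mv_scl, Hgh in H1 by apply Hcx.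
      replace (vscl (l / s) x) with (vscl l (vscl (/ s) x)) by (vec_eq; field; lra). assumption.
    + replace (s * m * (l / s)) with (l * m) by (field; lra). assumption.
  - exists (s * m), (l / s).
    split; [nra|]. split; [apply Rdiv_lt_0_compat; assumption|]. split; [|split].
    + apply (cle_mv g) in H2; [|assumption]. rewrite mv_scl in H2.
      assert (Hgh' : mv d g (mv d h x) = x) by (apply Hhg, Hcx).
      rewrite Hgh' in H2.
      replace (vscl (s * m) (vscl (/ s) (mv d g x))) with (vscl m (mv d g x)) by (vec_eq; field; lra).
      assumption.
    + replace (vscl (l / s) x) with (vscl (/ s) (vscl l x)) by (vec_eq; field; lra).
      apply cle_scl; [lra|assumption].
    + replace (s * m * (l / s)) with (l * m) by (field; lra). assumption.
Qed.

Lemma le_of_sqr_scaling (u w : R) :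
  0 < w -> (forall th, 1 < th -> u <= th * th * w) -> u <= w.
Proof.
  intros Hw H. apply Rnot_lt_le. intros Hlt.
  (* For [s <= 1] the square of [1 + s] is at most [1 + 3 * s], and [3 * s * w] is then at most half
     of [u - w]. *)
  set (s := Rmin 1 ((u - w) / (6 * w))).
  assert (0 < (u - w) / (6 * w)) by (apply Rdiv_lt_0_compat; lra).
  assert (Hs : 0 < s) by (apply Rmin_glb_lt; lra).
  assert (Hs1 : s <= 1) by apply Rmin_l.
  assert (Hs2 : s * (6 * w) <= u - w).
  { assert (s <= (u - w) / (6 * w)) by apply Rmin_r.
    apply (Rmult_le_compat_r (6 * w)) in H1; [|lra].
    replace ((u - w) / (6 * w) * (6 * w)) with (u - w) in H1 by (field; lra). assumption. }
  specialize (H (1 + s) ltac:(lra)).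
  assert ((1 + s) * (1 + s) <= 1 + 3 * s) by nra. nra.
Qed.

(** Minimal displacement controls only the product [l * m]. As [g] and [h] commute, a common
    almost-minimizer nearly realizes constants [b] and [c] admissible at unrelated points [y] and
    [z], so [l * m <= b * c]. Taking [c = m] or [b = l], both admissible at [x], separates the
    factors. *)
Lemma minset_near_min (g h : mat) (x : vec) :
  cone_map g -> cone_map h -> inv_pair d g h -> MinSet d phi Om g x ->
  near_min 1 g x /\ near_min 1 h x.
Proof.
  intros Hg Hh Hi (Hx & t & (Hlow & _) & Ht).
  assert (Hcx := cone_of_domain x Hx).
  destruct (proj1 (displacement_le_iff g h x t Hg Hh Hi Hx)) as (l & m & Hl & Hm & H1 & H2 & H3);
    [lra|].
  assert (Hopt : forall y z b c, cone Om y -> cone Om z -> 0 < b -> 0 < c ->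
    cle (mv d g y) (vscl b y) -> cle (mv d h z) (vscl c z) -> l * m <= b * c).
  { intros y z b c Hy Hz Hb Hc Hgy Hhz.
    apply le_of_sqr_scaling; [apply Rmult_lt_0_compat; assumption|]. intros th Hth.
    destruct (simultaneous_near_min Om (g :: h :: nil) th) as (w & Hw & Hnm).
    - apply domain_convex.
    - apply domain_inhabited.
    - auto.
    - assumption.
    - intros k [<-|[<-|[]]]; split; assumption.
    - destruct Hi as [Hi1 Hi2].
      intros k k' [<-|[<-|[]]] [<-|[<-|[]]] v Hv; try reflexivity;
        rewrite Hi1, Hi2 by assumption; reflexivity.
    - assert (Hgw : near_min th g (vnormalize w)) by (apply near_min_normalize; auto with datatypes).
      assert (Hhw : near_min th h (vnormalize w)) by (apply near_min_normalize; auto with datatypes).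
      assert (Hww : Om (vnormalize w)) by apply Hw.
      assert (Hp : 0 < th * b * (th * c)) by (repeat apply Rmult_lt_0_compat; lra).
      set (r := ln (th * b * (th * c)) / 2).
      assert (Hr : exp (2 * r) = th * b * (th * c)).
      { unfold r. replace (2 * (ln (th * b * (th * c)) / 2)) with (ln (th * b * (th * c))) by field.
        apply exp_ln, Hp. }
      assert (Htr : t <= r).
      { eapply Rle_trans; [apply (Hlow _ Hww)|].
        apply (displacement_le_iff g h); try assumption.
        exists (th * b), (th * c). do 2 (split; [nra|]).
        split; [apply (Hgw y); assumption|]. split; [apply (Hhw z); assumption|lra]. }
      eapply Rle_trans; [exact H3|]. replace (th * th * (b * c)) with (exp (2 * r)) by (rewrite Hr; ring).
      destruct Htr as [Htr| ->]; [left; apply exp_increasing; lra|right; reflexivity]. }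
  split; intros y b Hy Hb H; rewrite Rmult_1_l.
  - apply cle_weaken with l; [|apply ccone_of_cone; assumption|assumption].
    specialize (Hopt y x b m Hy Hcx Hb Hm H H2). nra.
  - apply cle_weaken with m; [|apply ccone_of_cone; assumption|assumption].
    specialize (Hopt x y l b Hcx Hy Hl Hb H1 H). nra.
Qed.

Lemma near_min_minset (g h : mat) (x : vec) :
  cone_map g -> cone_map h -> inv_pair d g h -> Om x ->
  near_min 1 g x -> near_min 1 h x -> MinSet d phi Om g x.
Proof.
  intros Hg Hh Hi Hx Hgx Hhx. split; [assumption|]. eexists. split; [|reflexivity]. split.
  - intros y Hy. apply (displacement_le_iff g h); try assumption.
    destruct (proj1 (displacement_le_iff g h y _ Hg Hh Hi Hy) (Rle_refl _))
      as (l & m & Hl & Hm & H1 & H2 & H3).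
    apply cone_of_domain in Hy. exists l, m. do 2 (split; [assumption|]).
    apply (Hgx y) in H1; [|assumption|assumption]. apply (Hhx y) in H2; [|assumption|assumption].
    rewrite Rmult_1_l in H1, H2. auto.
  - intros t' H. apply H, Hx.
Qed.

(** * Limits and balls *)

Lemma cle_limit (u v : nat -> vec) (a b : vec) (N : nat) :
  inRd d a -> inRd d b -> vcv d u a -> vcv d v b ->
  (forall n, (N <= n)%nat -> cle (u n) (v n)) -> cle a b.
Proof.
  intros Ha Hb Hu Hv H. apply cle_closed; [assumption|assumption|]. intros eps He.
  destruct (vcv_close d u a eps Hu He) as [N1 H1].
  destruct (vcv_close d v b eps Hv He) as [N2 H2].
  exists (u (N + N1 + N2)%nat), (v (N + N1 + N2)%nat).
  split; [apply H; lia|]. split; [apply H1; lia|apply H2; lia].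
Qed.

Lemma near_min_limit (g : mat) (u : nat -> vec) (z : vec) :
  cone Om z -> vcv d u z ->
  (forall th, 1 < th -> exists N, forall n, (N <= n)%nat -> near_min th g (u n)) ->
  near_min 1 g z.
Proof.
  intros Hz Hu H y b Hy Hb Hgy. rewrite Rmult_1_l.
  apply cle_inf; [apply mv_inRd|assumption|]. intros th Hth.
  destruct (H th Hth) as [N HN].
  apply (cle_limit (fun n => mv d g (u n)) (fun n => vscl (th * b) (u n)) _ _ N).
  - apply mv_inRd.
  - apply inRd_scl, Hz.
  - apply vcv_mv, Hu.
  - apply vcv_scl, Hu.
  - intros n Hn. apply (HN n Hn y); assumption.
Qed.

(** A multiplicative stand-in for a Hilbert ball around [x0]. It is given by closed conditions, and
    the second one keeps [x] away from the boundary. *)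
Definition ball (x0 : vec) (r : R) (x : vec) : Prop :=
  cle x (vscl r x0) /\ cle x0 (vscl r x).

Lemma ball_weaken (x0 x : vec) (r r' : R) :
  Om x0 -> Om x -> r <= r' -> ball x0 r x -> ball x0 r' x.
Proof.
  intros H0 Hx Hr [H1 H2]. split.
  - eapply cle_weaken; [exact Hr|apply ccone_of_cone, cone_of_domain, H0|exact H1].
  - eapply cle_weaken; [exact Hr|apply ccone_of_cone, cone_of_domain, Hx|exact H2].
Qed.

(** Evaluating [phi] on the two inequalities puts [phi v] between [/ q] and [p], so normalizing
    worsens each constant at most to [p * q]. *)
Lemma ball_normalize (x0 v : vec) (p q : R) :
  Om x0 -> cone Om v -> 0 < p -> 0 < q -> cle v (vscl p x0) -> cle x0 (vscl q v) ->
  ball x0 (p * q) (vnormalize v).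
Proof.
  intros H0 Hv Hp Hq H1 H2. destruct (domain_chart x0 H0) as [_ Hl0].
  assert (Hl : 0 < lin d phi v) by apply Hv. unfold vnormalize.
  assert (Hl1 := ccone_lin _ H1). rewrite lin_add, !lin_scl, Hl0 in Hl1.
  assert (Hl2 := ccone_lin _ H2). rewrite lin_add, !lin_scl, Hl0 in Hl2.
  set (l := lin d phi v) in *. assert (Hil : 0 < / l) by (apply Rinv_0_lt_compat, Hl).
  assert (Hlil : l * / l = 1) by (apply Rinv_r; lra).
  assert (Hlq : / l <= q).
  { apply Rmult_le_reg_l with l; [assumption|]. rewrite Hlil. lra. }
  assert (Hlp : 1 <= p * / l).
  { apply Rmult_le_reg_r with l; [assumption|]. rewrite Rmult_assoc, Rinv_l; lra. }
  split.
  - apply cle_weaken with (/ l * p).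
    + rewrite Rmult_comm. apply Rmult_le_compat_l; lra.
    + apply ccone_of_cone, cone_of_domain, H0.
    + replace (vscl (/ l * p) x0) with (vscl (/ l) (vscl p x0)) by vec_eq.
      apply cle_scl; [lra|assumption].
  - replace (vscl (p * q) (vscl (/ l) v)) with (vscl (p * q * / l) v) by vec_eq.
    apply cle_weaken with q; [|apply ccone_of_cone, Hv|assumption].
    replace (p * q * / l) with (p * / l * q) by ring.
    apply Rle_trans with (1 * q); [lra|]. apply Rmult_le_compat_r; lra.
Qed.

Lemma ball_subseq (x0 : vec) (r : R) (u : nat -> vec) :
  Om x0 -> 0 < r -> (forall n, Om (u n)) -> (forall n, ball x0 r (u n)) ->
  exists s z, strictly_increasing s /\ Om z /\ ball x0 r z /\ vcv d (fun n => u (s n)) z.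
Proof.
  intros H0 Hr Hu Hb. destruct Hdom as (_ & _ & _ & _ & _ & M & HM).
  destruct (family_subseq nat (seq 0 d) u) as (s & Hs & Hcv).
  { intros i _. exists M. intros n. apply HM, Hu. }
  destruct (choice_function nat R (fun i z => (i < d)%nat -> Un_cv (fun n => u (s n) i) z))
    as [f Hf].
  { intros i. destruct (lt_dec i d) as [Hi|Hi].
    - destruct (Hcv i) as [z Hz]; [apply in_seq; lia|]. exists z. auto.
    - exists 0. intros; contradiction. }
  set (z := (fun i => if Nat.ltb i d then f i else 0) : vec).
  assert (Hz : inRd d z).
  { intros i Hi. unfold z. destruct (Nat.ltb_spec i d); [lia|reflexivity]. }
  assert (Hvcv : vcv d (fun n => u (s n)) z).
  { intros i Hi. unfold z. destruct (Nat.ltb_spec i d); [auto|lia]. }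
  destruct (domain_chart x0 H0) as [H0d _].
  assert (Hball : ball x0 r z).
  { split.
    - apply (cle_limit (fun n => u (s n)) (fun _ => vscl r x0) _ _ 0).
      + assumption.
      + apply inRd_scl, H0d.
      + assumption.
      + apply vcv_const.
      + intros n _. apply Hb.
    - apply (cle_limit (fun _ => x0) (fun n => vscl r (u (s n))) _ _ 0).
      + assumption.
      + apply inRd_scl, Hz.
      + apply vcv_const.
      + apply vcv_scl, Hvcv.
      + intros n _. apply Hb. }
  exists s, z. split; [assumption|]. split; [|split; assumption].
  apply domain_of_cone.
  (* The limit is interior because [r z] is the sum of [r z - x0], in the closed cone, and [x0], in
     the open one. *)
  - apply (cone_scl_inv _ r); [assumption|].
    destruct Hball as [_ [_ H]]. specialize (H x0 (cone_of_domain x0 H0)).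
    replace (vscl r z) with (vadd (vadd (vscl r z) (vscl (-1) x0)) x0) by vec_eq. assumption.
  - apply (UL_sequence (fun n => lin d phi (u (s n)))); [apply vcv_lin, Hvcv|].
    replace (fun n => lin d phi (u (s n))) with (fun _ : nat => 1).
    + intros eps He. exists 0%nat. intros n _. rewrite Rdist_eq. assumption.
    + extensionality n. symmetry. apply domain_chart, Hu.
Qed.

Lemma compact_in_ball (x0 : vec) (Q : vec -> Prop) :
  Om x0 -> compact d Q -> (forall x, Q x -> Om x) ->
  exists r, 0 < r /\ forall x, Q x -> ball x0 r x.
Proof.
  intros H0 HQ HQO. apply NNPP. intros Hno.
  assert (Hch : forall n, exists x, Q x /\ ~ ball x0 (INR n + 1) x).
  { intros n. apply NNPP. intros Hn. apply Hno. exists (INR n + 1).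
    split; [pose proof (pos_INR n); lra|]. intros x Hx. apply NNPP. intros Hx'.
    apply Hn. exists x. auto. }
  destruct (choice_function _ _ _ Hch) as [u Hu].
  destruct (HQ u) as (s & z & Hs & HzQ & Hcv); [apply Hu|].
  assert (Hz := cone_of_domain z (HQO z HzQ)).
  (* Halving [z] leaves room: for [u] near [z], [u - z/2 = z/2 + (u - z)] is in the cone, so a bound
     of [x0] by [z/2] becomes one by [u]. *)
  assert (Hz2 : cone Om (vscl (/ 2) z)) by (apply cone_scl; [lra|assumption]).
  assert (Hc0 := cone_of_domain x0 H0).
  destruct (cone_open _ Hz2) as (eps & He & Hop).
  destruct (vcv_close d _ z eps Hcv He) as [N HN].
  destruct (cle_unit x0 (vscl (/ 2) z) Hz2 (cone_inRd _ _ Hc0)) as (k & Hk & Hxk).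
  destruct (cone_absorbs x0 Hc0) as (k' & Hk' & Hab).
  destruct Hdom as (_ & _ & _ & _ & _ & M & HM).
  assert (HM0 : 0 <= M) by (eapply Rle_trans; [apply Rabs_pos|apply (HM _ 0%nat H0)]).
  destruct (INR_unbounded (k + k' * M)) as [N' HN'].
  set (n := (N + N')%nat).
  assert (Hsn : (n <= s n)%nat) by exact (strictly_increasing_ge s n Hs).
  assert (Hnum : k + k' * M <= INR (s n) + 1).
  { assert (INR N' <= INR (s n)) by (apply le_INR; unfold n in *; lia). lra. }
  assert (Hkm : 0 <= k' * M) by (apply Rmult_le_pos; lra).
  destruct (Hu (s n)) as [HuQ Hub]. assert (HuO := cone_of_domain _ (HQO _ HuQ)).
  apply Hub. split.
  - apply cle_weaken with (k' * M); [lra|apply ccone_of_cone, Hc0|].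
    apply Hab; [assumption|apply HuO|]. intros i _. apply HM, HQO, HuQ.
  - apply cle_weaken with (k * 1); [lra|apply ccone_of_cone, HuO|].
    eapply cle_scl_chain; [lra|exact Hxk|]. unfold cle.
    replace (vadd (vscl 1 (u (s n))) (vscl (-1) (vscl (/ 2) z))) with
      (vadd (vscl (/ 2) z) (vadd (u (s n)) (vscl (-1) z))) by (vec_eq; field).
    apply ccone_of_cone, Hop.
    + apply inRd_add; [apply HuO|apply inRd_scl, Hz].
    + intros i Hi. specialize (HN n ltac:(unfold n; lia) i Hi). unfold vadd, vscl.
      replace (u (s n) i + -1 * z i) with (u (s n) i - z i) by ring. lra.
Qed.

(** * Proper discontinuity *)

Lemma entry_bound (x0 : vec) (B : R) :
  Om x0 -> 0 < B -> exists E, 0 < E /\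
    forall g, cone_map g -> cle (mv d g x0) (vscl B x0) ->
      forall i j, (i < d)%nat -> (j < d)%nat -> Rabs (g i j) <= E.
Proof.
  intros H0 HB. assert (Hc0 := cone_of_domain x0 H0).
  destruct (domain_chart x0 H0) as [_ Hl0].
  destruct (cone_absorbs x0 Hc0) as (k & Hk & Hab). destruct ccone_bound as (M & HM & Hcb).
  exists (M * (k * 1 * B)). split; [repeat apply Rmult_lt_0_compat; lra|].
  intros g Hg Hgx i j Hi Hj.
  assert (Hb : forall e, Rabs e <= 1 -> cle (vscl e (vbasis j)) (vscl (k * 1) x0)).
  { intros e He. apply Hab; [lra|apply inRd_scl, inRd_basis, Hj|].
    intros i' _. unfold vscl, vbasis. destruct (Nat.eqb i' j).
    - rewrite Rmult_1_r. assumption.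
    - rewrite Rmult_0_r, Rabs_R0. lra. }
  assert (Hgb : forall e, Rabs e <= 1 ->
    cle (vscl e (mv d g (vbasis j))) (vscl (k * 1 * B) x0)).
  { intros e He. eapply cle_scl_chain; [lra| |exact Hgx].
    rewrite <- !mv_scl. apply cle_mv; [assumption|auto]. }
  assert (H1 := Hgb 1 ltac:(rewrite Rabs_R1; lra)).
  assert (H2 := Hgb (-1) ltac:(rewrite Rabs_left; lra)).
  set (t := k * 1 * B) in *.
  destruct (Hcb _ H1) as [_ H1i]. destruct (Hcb _ H2) as [_ H2i].
  specialize (H1i i). specialize (H2i i).
  rewrite lin_add, !lin_scl, Hl0 in H1i, H2i. unfold vadd, vscl in H1i, H2i.
  rewrite mv_basis in H1i, H2i by assumption.
  set (w := lin d phi (mv d g (vbasis j))) in *.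
  (* [phi] takes the values [t - w] and [t + w] on the two vectors, so the uncontrolled [w] cancels
     when the two bounds are added. *)
  assert (Hsum : Rabs (2 * g i j) <= 2 * (M * t)).
  { replace (2 * g i j) with ((t * x0 i + -1 * (-1 * g i j)) + - (t * x0 i + -1 * (1 * g i j)))
      by ring.
    eapply Rle_trans; [apply Rabs_triang|]. rewrite Rabs_Ropp. lra. }
  rewrite Rabs_mult, (Rabs_right 2) in Hsum by lra. lra.
Qed.

Lemma proj_eq_pos (g h : mat) :
  cone_map g -> cone_map h -> proj_eq d g h ->
  exists c, 0 < c /\ forall v, mv d g v = vscl c (mv d h v).
Proof.
  intros Hg Hh (c & Hc & H). exists c.
  assert (E : forall v, mv d g v = vscl c (mv d h v)) by (intros; apply mv_proj, H).
  split; [|assumption]. destruct domain_inhabited as [x Hx]. apply cone_of_domain in Hx.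
  destruct (Hg x Hx) as (_ & H1 & _). destruct (Hh x Hx) as (_ & H2 & _).
  rewrite E, lin_scl in H1. nra.
Qed.

Lemma subgroup_mul (G : mat -> Prop) (g h : mat) :
  PGL_subgroup d G -> pos G g -> pos G h -> pos G (mmul d g h).
Proof.
  intros (_ & _ & _ & HG & _) [Hg1 Hg2] [Hh1 Hh2]. split; [apply HG; assumption|].
  intros v Hv. rewrite mv_mmul. auto.
Qed.

(** Bounded entries yield an entrywise convergent subsequence. If the projective classes were not
    eventually constant along it, there would be nontrivial quotients of ever later terms; the
    inverses being bounded too, these quotients would tend to the identity, against discreteness. *)
Lemma bounded_orbit_subseq (L : mat -> Prop) (x0 : vec) (B : R) (b b' : nat -> mat) :
  PGL_subgroup d L -> PGL_discrete d L -> Om x0 -> 0 < B ->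
  (forall n, pos L (b n) /\ pos L (b' n) /\ inv_pair d (b n) (b' n)) ->
  (forall n, cle (mv d (b n) x0) (vscl B x0) /\ cle (mv d (b' n) x0) (vscl B x0)) ->
  exists s, strictly_increasing s /\ forall m n, proj_eq d (b (s m)) (b (s n)).
Proof.
  intros HL Hdisc H0 HB Hb Hbd.
  destruct (entry_bound x0 B H0 HB) as (E & HE & Hent).
  destruct (family_subseq (nat * nat) (list_prod (seq 0 d) (seq 0 d))
              (fun n p => b n (fst p) (snd p))) as (s & Hs & Hcv).
  { intros [i j] Hij. apply in_prod_iff in Hij. rewrite !in_seq in Hij.
    exists E. intros n. apply Hent; simpl; try lia; apply (Hb n) || apply (Hbd n). }
  assert (Hev : exists N, forall m n, (N <= m)%nat -> (N <= n)%nat ->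
                  proj_eq d (b (s m)) (b (s n))).
  { apply NNPP. intros Hno.
    assert (Hch : forall N, exists q : nat * nat, (N <= fst q)%nat /\ (N <= snd q)%nat /\
               ~ proj_eq d (b (s (fst q))) (b (s (snd q)))).
    { intros N. apply NNPP. intros Hn. apply Hno. exists N. intros m n Hm Hn'.
      apply NNPP. intros Hp. apply Hn. exists (m, n). auto. }
    destruct (choice_function _ _ _ Hch) as [q Hq].
    set (p1 := fun N => s (fst (q N))). set (p2 := fun N => s (snd (q N))).
    apply Hdisc. exists (fun N => mmul d (b' (p2 N)) (b (p1 N))), (fun _ => 1). split.
    - intros N. destruct (Hq N) as (_ & _ & Hnp).
      destruct (Hb (p1 N)) as ([HL1 _] & _ & _).
      destruct (Hb (p2 N)) as (_ & [HL2 _] & [_ Hinv]).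
      split; [apply HL; assumption|]. intros (c & Hc & Heq). apply Hnp.
      exists c. split; [assumption|]. apply mat_ext_mv. intros v Hv. fold (p1 N) (p2 N).
      rewrite <- (Hinv (mv d (b (p1 N)) v)) by apply mv_inRd.
      rewrite <- (mv_mmul d (b' (p2 N))), (mv_proj d _ mid c v Heq), mv_scl, mv_mid by assumption. reflexivity.
    - intros i j Hi Hj.
      assert (Hk : forall k, (k < d)%nat ->
        Un_cv (fun N => b' (p2 N) i k * (b (p1 N) k j - b (p2 N) k j)) 0).
      { intros k Hk. destruct (Hcv (k, j)) as [z Hz]; [apply in_prod; apply in_seq; lia|].
        simpl in Hz.
        assert (H1 : Un_cv (fun N => b (p1 N) k j) z).
        { apply (cv_reindex (fun n => b (s n) k j) z (fun N => fst (q N))); [|assumption].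
          intros N. apply Hq. }
        assert (H2 : Un_cv (fun N => b (p2 N) k j) z).
        { apply (cv_reindex (fun n => b (s n) k j) z (fun N => snd (q N))); [|assumption].
          intros N. apply Hq. }
        intros eps He. destruct (CV_minus _ _ _ _ H1 H2 (eps / E)) as [N HN];
          [apply Rdiv_lt_0_compat; assumption|].
        exists N. intros n Hn. specialize (HN n Hn). unfold R_dist in *.
        rewrite Rminus_diag, Rminus_0_r in HN. rewrite Rminus_0_r, Rabs_mult.
        assert (Hbe : Rabs (b' (p2 n) i k) <= E).
        { apply Hent; try assumption; apply (Hb (p2 n)) || apply (Hbd (p2 n)). }
        apply Rle_lt_trans with (E * Rabs (b (p1 n) k j - b (p2 n) k j)).
        - apply Rmult_le_compat_r; [apply Rabs_pos|assumption].
        - apply (Rmult_lt_compat_l E) in HN; [|assumption].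
          replace (E * (eps / E)) with eps in HN by (field; lra). assumption. }
      apply (cv_fsum d _ (fun _ => 0)) in Hk. rewrite fsum_zero in Hk.
      intros eps He. destruct (Hk eps He) as [N HN]. exists N. intros n Hn.
      specialize (HN n Hn). unfold R_dist in *.
      replace (1 * mmul d (b' (p2 n)) (b (p1 n)) i j - mid i j) with
        (fsum d (fun k => b' (p2 n) i k * (b (p1 n) k j - b (p2 n) k j)) - 0); [assumption|].
      assert (Hid : mid i j = fsum d (fun k => b' (p2 n) i k * b (p2 n) k j)).
      { destruct (Hb (p2 n)) as (_ & _ & [Hinv _]).
        rewrite <- (mv_basis d mid i j), mv_mid by (assumption || apply inRd_basis, Hj).
        rewrite <- (Hinv (vbasis j)) by (apply inRd_basis, Hj).
        rewrite mv_lt by assumption. apply fsum_ext. intros k Hk'.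
        rewrite mv_basis by assumption. reflexivity. }
      rewrite Hid. unfold mmul.
      rewrite (fsum_ext d (fun k => b' (p2 n) i k * (b (p1 n) k j - b (p2 n) k j))
                 (fun k => b' (p2 n) i k * b (p1 n) k j + -1 * (b' (p2 n) i k * b (p2 n) k j)))
        by (intros; ring).
      rewrite fsum_add, fsum_scl. ring. }
  destruct Hev as [N HN]. exists (fun n => s (N + n)%nat). split.
  - intros n. replace (N + S n)%nat with (S (N + n)) by lia. apply Hs.
  - intros m n. apply HN; lia.
Qed.

(** Otherwise every finite list in [S] misses a class, and repeatedly adjoining a missed element
    gives a sequence of pairwise distinct classes, of which no subsequence is constant. *)
Lemma finite_classes (L S : mat -> Prop) (x0 : vec) (B : R) :
  PGL_subgroup d L -> PGL_discrete d L -> Om x0 -> 0 < B ->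
  (forall g, S g -> pos L g /\ cle (mv d g x0) (vscl B x0) /\
     exists h, pos L h /\ inv_pair d g h /\ cle (mv d h x0) (vscl B x0)) ->
  exists l, (forall g, In g l -> S g) /\ forall g, S g -> exists h, In h l /\ proj_eq d g h.
Proof.
  intros HL Hdisc H0 HB HS. apply NNPP. intros Hno.
  destruct (choice_function (list mat) mat (fun l g => (forall h, In h l -> S h) ->
              S g /\ forall h, In h l -> ~ proj_eq d g h)) as [f Hf].
  { intros l. apply NNPP. intros Hn. apply Hno. exists l. split.
    - intros g Hg. apply NNPP. intros HSg. apply Hn. exists g. intros Hl. destruct (HSg (Hl g Hg)).
    - intros g Hg. apply NNPP. intros Hg'. apply Hn. exists g. intros _. split; [assumption|].
      intros h Hh Hp. apply Hg'. exists h. auto. }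
  set (ls := fix ls n := match n with 0%nat => nil | Datatypes.S m => f (ls m) :: ls m end).
  assert (Hls : forall n h, In h (ls n) -> S h).
  { induction n; intros h; simpl; [intros []|]. intros [<-|Hh]; [apply Hf|]; auto. }
  assert (Hin : forall m n, (m < n)%nat -> In (f (ls m)) (ls n)).
  { intros m n Hmn. induction Hmn; simpl; auto. }
  assert (Hfn : forall n, S (f (ls n))) by (intros n; apply Hf, Hls).
  destruct (choice_function nat mat (fun n h => pos L h /\ inv_pair d (f (ls n)) h /\
              cle (mv d h x0) (vscl B x0))) as [b' Hb'].
  { intros n. apply HS, Hfn. }
  destruct (bounded_orbit_subseq L x0 B (fun n => f (ls n)) b') as (s & Hs & Hp); try assumption.
  - intros n. split; [apply HS, Hfn|]. split; apply Hb'.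
  - intros n. split; [apply HS, Hfn|apply Hb'].
  - destruct (Hf (ls (s 1%nat)) (Hls _)) as [_ H]. apply (H (f (ls (s 0%nat)))); [|apply Hp].
    apply Hin, Hs.
Qed.

(** * Abelian subgroups of a naive convex co-compact group *)

Section Action.

Context (C : vec -> Prop) (L A : mat -> Prop).
Hypothesis HL : PGL_subgroup d L.
Hypothesis HLaut : forall g, L g -> Aut d phi Om g.
Hypothesis Hdisc : PGL_discrete d L.
Hypothesis HCne : exists x, C x.
Hypothesis HCO : forall x, C x -> Om x.
Hypothesis HCclosed : closed_in d Om C.
Hypothesis HCconvex : convex C.
Hypothesis HCinv : forall g x, L g -> C x -> C (pact d phi g x).
Hypothesis HCcocompact : cocompact d phi L C.
Hypothesis HA : PGL_subgroup d A.
Hypothesis HAL : forall a, A a -> L a.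
Hypothesis HAab : forall a b, A a -> A b -> proj_eq d (mmul d a b) (mmul d b a).

Lemma A_aut (a : mat) : A a -> Aut d phi Om a.
Proof. auto. Qed.

Lemma pos_A_L (a : mat) : pos A a -> pos L a.
Proof. intros [H1 H2]. split; auto. Qed.

Lemma proj_commute (a b : mat) :
  cone_map a -> cone_map b -> proj_eq d (mmul d a b) (mmul d b a) -> mcommute d a b.
Proof.
  intros Ha Hb (c & _ & H).
  assert (E : forall v, inRd d v -> mv d a (mv d b v) = vscl c (mv d b (mv d a v))).
  { intros v _. rewrite <- !mv_mmul. apply mv_proj, H. }
  assert (Hc : c = 1) by (apply (scalar_commutator_one a b); assumption). subst c.
  intros v Hv. rewrite E by assumption. vec_eq.
Qed.

Lemma pact_mscl (c : R) (g : mat) (x : vec) :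
  c <> 0 -> Aut d phi Om g -> Om x -> pact d phi (mscl c g) x = pact d phi g x.
Proof.
  intros Hc (_ & Hg & _) Hx. rewrite !pact_normalize, mv_mscl.
  apply vnormalize_scl; [assumption|apply Hg, Hx].
Qed.

Lemma minset_mscl (c : R) (g : mat) (x : vec) :
  c <> 0 -> Aut d phi Om g -> (MinSet d phi Om (mscl c g) x <-> MinSet d phi Om g x).
Proof.
  intros Hc Hg. unfold MinSet, is_tau.
  assert (E : forall y, Om y -> pact d phi (mscl c g) y = pact d phi g y).
  { intros; apply pact_mscl; assumption. }
  split; intros (Hx & t & (H1 & H2) & H3); (split; [assumption|]); exists t;
    rewrite E in * by assumption; (split; [split|assumption]).
  - intros y Hy. rewrite <- E by assumption. auto.
  - intros t' H'. apply H2. intros y Hy. rewrite E by assumption. auto.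
  - intros y Hy. rewrite E by assumption. auto.
  - intros t' H'. apply H2. intros y Hy. rewrite <- E by assumption. auto.
Qed.

(** As [A] contains inverses, the second condition of minimality, on the inverse, is the first
    condition for another element. *)
Lemma minC_iff (x : vec) :
  MinC d phi Om C A x <-> C x /\ forall a, pos A a -> near_min 1 a x.
Proof.
  split.
  - intros [Hx H]. split; [assumption|]. intros a Ha.
    destruct (pos_inverse A a HA A_aut Ha) as (h & Hh & Hi).
    apply (minset_near_min a h x); [apply Ha|apply Hh|assumption|apply H, Ha].
  - intros [Hx H]. split; [assumption|]. intros a Ha.
    destruct (pos_lift A a HA A_aut Ha) as (c & Hc & Hca).
    apply (minset_mscl c); [assumption|auto|].
    destruct (pos_inverse A _ HA A_aut Hca) as (h & Hh & Hi).
    apply (near_min_minset _ h); [apply Hca|apply Hh|assumption|auto|auto|auto].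
Qed.

Lemma minC_convex : convex (MinC d phi Om C A).
Proof.
  intros x y t Hx Hy Ht. rewrite minC_iff in *. destruct Hx as [Hx1 Hx2], Hy as [Hy1 Hy2].
  split; [apply HCconvex; assumption|]. intros a Ha. apply near_min_comb; auto.
Qed.

(** The centralizer seen on positive lifts, where commutation holds exactly and not just up to a
    scalar. *)
Definition pcentral (g : mat) : Prop := pos L g /\ forall a, pos A a -> mcommute d g a.

Lemma cone_C_map (g : mat) : pos L g -> forall v, cone C v -> cone C (mv d g v).
Proof.
  intros [Hg1 Hg2]. apply cone_map_of_pos; [|intros; apply HCinv; assumption].
  intros x Hx. apply Hg2, cone_of_domain, HCO, Hx.
Qed.

Lemma pcentral_minC (g : mat) (x : vec) :
  pcentral g -> MinC d phi Om C A x -> MinC d phi Om C A (vnormalize (mv d g x)).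
Proof.
  intros [Hg Hc] Hx. rewrite minC_iff in *. destruct Hx as [Hx1 Hx2].
  split; [apply (cone_C_map g Hg), cone_of_set; assumption|].
  assert (Hcx := cone_of_domain x (HCO x Hx1)).
  intros a Ha. apply near_min_normalize; [apply Hg, Hcx|].
  apply near_min_comm; [apply Hg|apply Hcx|apply Hc, Ha|auto].
Qed.

Lemma pcentral_centralizer (g : mat) : pcentral g -> centralizer d L A g.
Proof.
  intros [Hg Hc]. split; [apply Hg|]. intros a Ha.
  destruct (pos_lift A a HA A_aut Ha) as (c & Hc0 & Hca). exists 1. split; [lra|].
  apply mat_ext_mv. intros v Hv. rewrite !mv_mmul.
  specialize (Hc _ Hca v Hv). rewrite !mv_mscl, mv_scl in Hc.
  extensionality i. apply (f_equal (fun u => u i)) in Hc. unfold vscl in *.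
  rewrite Rmult_1_l. apply Rmult_eq_reg_l with c; assumption.
Qed.

Lemma centralizer_lift (g : mat) :
  centralizer d L A g -> exists c, c <> 0 /\ pcentral (mscl c g).
Proof.
  intros [Hg Hc]. destruct (pos_lift L g HL HLaut Hg) as (c & Hc0 & Hcg).
  exists c. split; [assumption|]. split; [assumption|]. intros a Ha.
  apply proj_commute; [apply Hcg|apply Ha|].
  destruct (Hc a (proj1 Ha)) as (k & Hk & H). exists k. split; [assumption|].
  apply mat_ext_mv. intros v Hv.
  rewrite !mv_mmul, !mv_mscl, mv_scl, <- !mv_mmul, (mv_proj d _ _ k v H). vec_eq.
Qed.

Lemma pcentral_inverse (g : mat) :
  pcentral g -> exists h, pcentral h /\ inv_pair d g h.
Proof.
  intros [Hg Hc]. destruct (pos_inverse L g HL HLaut Hg) as (h & Hh & Hi).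
  exists h. split; [|assumption]. split; [assumption|]. intros a Ha v Hv.
  destruct Hi as [Hi1 Hi2].
  rewrite <- (Hi2 v) at 1 by assumption.
  rewrite <- (Hc a Ha) by apply mv_inRd. apply Hi1, mv_inRd.
Qed.

(** The list is closed under inverses because the discreteness argument needs a displacement bound
    for each conjugate and for its inverse. *)
Lemma central_test_list : exists F : list mat,
  (forall a, In a F -> pos A a /\ exists a', In a' F /\ inv_pair d a a') /\
  forall g, pos L g -> (forall a, In a F -> mcommute d g a) -> pcentral g.
Proof.
  destruct (commutant_list d (pos A)) as (l & Hl & Hcom).
  destruct (choice_function mat mat (fun a h => pos A a -> pos A h /\ inv_pair d a h))
    as [inv Hinv].
  { intros a. destruct (classic (pos A a)) as [Ha|Ha].
    - destruct (pos_inverse A a HA A_aut Ha) as (h & Hh). exists h. auto.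
    - exists a. intros; contradiction. }
  exists (l ++ map inv l). split.
  - intros a Ha. apply in_app_or in Ha. destruct Ha as [Ha|Ha].
    + split; [auto|]. exists (inv a). split; [apply in_or_app; right; apply in_map, Ha|].
      apply Hinv; auto.
    + apply in_map_iff in Ha. destruct Ha as (b & <- & Hb).
      destruct (Hinv b (Hl b Hb)) as [H1 H2]. split; [assumption|]. exists b.
      split; [apply in_or_app; left; assumption|apply inv_pair_sym; assumption].
  - intros g Hg H. split; [assumption|]. apply Hcom. intros x Hx. apply H, in_or_app. auto.
Qed.

Lemma orbit_point (Q : vec -> Prop) (x : vec) :
  (forall k, Q k -> C k) -> (exists g k, L g /\ Q k /\ x = pact d phi g k) ->
  exists g h k, pos L g /\ pos L h /\ inv_pair d g h /\ Q k /\ x = vnormalize (mv d g k).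
Proof.
  intros HQ (g & k & Hg & Hk & ->).
  destruct (pos_lift L g HL HLaut Hg) as (c & Hc & Hcg).
  destruct (pos_inverse L _ HL HLaut Hcg) as (h & Hh & Hi).
  exists (mscl c g), h, k. do 4 (split; [assumption|]).
  rewrite <- pact_normalize, pact_mscl; auto.
Qed.

Lemma conj_inv_pair (g h a a' : mat) :
  inv_pair d g h -> inv_pair d a a' ->
  inv_pair d (mmul d h (mmul d a g)) (mmul d h (mmul d a' g)).
Proof.
  intros [Hg1 Hg2] [Ha1 Ha2]. split; intros v Hv; rewrite !mv_mmul, Hg2 by apply mv_inRd.
  - rewrite Ha1 by apply mv_inRd. auto.
  - rewrite Ha2 by apply mv_inRd. auto.
Qed.

(* Conjugating [F] along the orbit yields elements of [L] displacing [x0] by a bounded amount,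
   hence finitely many by discreteness; two equal conjugates differ by a central element. *)
Lemma central_return (F : list mat) (x0 : vec) (x : nat -> vec) :
  (forall a, In a F -> pos A a /\ exists a', In a' F /\ inv_pair d a a') ->
  (forall g, pos L g -> (forall a, In a F -> mcommute d g a) -> pcentral g) ->
  Om x0 -> (forall n, C (x n)) ->
  (forall a, In a F -> exists B, 0 < B /\ forall n, cle (mv d a (x n)) (vscl B (x n))) ->
  exists s del r, strictly_increasing s /\ 0 < r /\
    forall n, pcentral (del n) /\ ball x0 r (vnormalize (mv d (del n) (x (s n)))).
Proof.
  intros HF HFc H0 HxC HFb. assert (Hc0 := cone_of_domain x0 H0).
  destruct HCcocompact as (Q & HQ & HQC & _ & HQorb).
  destruct (compact_in_ball x0 Q H0 HQ) as (r0 & Hr0 & HQb); [auto|].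
  destruct (choice_function nat (mat * mat * vec) (fun n p =>
    let '(g, h, k) := p in
    pos L g /\ pos L h /\ inv_pair d g h /\ Q k /\ x n = vnormalize (mv d g k))) as [p Hp].
  { intros n. destruct (orbit_point Q (x n) HQC (HQorb _ (HxC n))) as (g & h & k & H).
    exists (g, h, k). exact H. }
  set (g := fun n => fst (fst (p n))). set (h := fun n => snd (fst (p n))).
  set (k := fun n => snd (p n)).
  assert (Hg : forall n, pos L (g n) /\ pos L (h n) /\ inv_pair d (g n) (h n) /\ Q (k n) /\
                x n = vnormalize (mv d (g n) (k n))).
  { intros n. unfold g, h, k. specialize (Hp n). destruct (p n) as [[g' h'] k']. exact Hp. }
  clearbody g h k. clear p Hp.
  assert (Hck : forall n, cone Om (k n)).
  { intros n. apply cone_of_domain, HCO, HQC, Hg. }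
  assert (Hgk : forall n, exists t, 0 < t /\ mv d (g n) (k n) = vscl t (x n)).
  { intros n. destruct (Hg n) as ([_ Hgn] & _ & _ & _ & ->).
    destruct (Hgn (k n) (Hck n)) as (_ & Ht & _).
    exists (lin d phi (mv d (g n) (k n))). split; [assumption|].
    unfold vnormalize. vec_eq. field. lra. }
  set (cj := fun (a : mat) n => mmul d (h n) (mmul d a (g n))).
  assert (Hcjpos : forall a n, pos A a -> pos L (cj a n)).
  { intros a n Ha. destruct (Hg n) as (H1 & H2 & _).
    apply subgroup_mul, subgroup_mul; auto using pos_A_L. }
  assert (Hcjb : forall a, In a F -> exists B, 0 < B /\ forall n,
             cle (mv d (cj a n) x0) (vscl B x0)).
  { intros a Ha. destruct (HFb a Ha) as (B & HB & HBn).
    (* From [x0 <= r0 k], the bound [B] for the conjugate at [k], and [k <= r0 x0]. *)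
    exists (r0 * (B * r0)). split; [repeat apply Rmult_lt_0_compat; assumption|]. intros n.
    destruct (Hg n) as (_ & [_ Hhn] & [Hgh _] & HQk & _).
    destruct (Hgk n) as (t & Ht & Hgt). destruct (HQb _ HQk) as [Hk1 Hk2].
    apply (cle_scl_chain _ (mv d (cj a n) (k n))); [lra| |].
    - rewrite <- mv_scl. apply cle_mv; [|assumption]. apply (Hcjpos a n), HF, Ha.
    - apply (cle_scl_chain _ (k n)); [lra| |assumption].
      unfold cj. rewrite !mv_mmul, Hgt.
      replace (vscl B (k n)) with (mv d (h n) (vscl t (vscl B (x n)))).
      + rewrite mv_scl. apply cle_mv; [assumption|]. apply cle_scl; [lra|apply HBn].
      + replace (vscl t (vscl B (x n))) with (vscl B (mv d (g n) (k n))) by (rewrite Hgt; vec_eq).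
        rewrite mv_scl, Hgh by apply Hck. reflexivity. }
  (* The elements of [F] are handled one at a time; constancy of the classes already obtained
     survives further subsequences. *)
  assert (Hsub : forall F', incl F' F -> exists s, strictly_increasing s /\
             forall a, In a F' -> forall m n, proj_eq d (cj a (s m)) (cj a (s n))).
  { induction F' as [|a F' IH]; intros Hincl.
    - exists (fun n => n). split; [intros n; lia|intros a []].
    - destruct IH as (s & Hs & Hconst); [intros b Hb; apply Hincl; right; assumption|].
      assert (Ha : In a F) by (apply Hincl; left; reflexivity).
      destruct (HF a Ha) as (Hpa & a' & Ha' & Hinv).
      destruct (Hcjb a Ha) as (B & HB & HBn). destruct (Hcjb a' Ha') as (B' & HB' & HBn').
      destruct (bounded_orbit_subseq L x0 (B + B') (fun n => cj a (s n)) (fun n => cj a' (s n)))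
        as (t & Ht & Hpe); try assumption; [lra| | |].
      + intros n. split; [apply Hcjpos, Hpa|]. split; [apply Hcjpos, HF, Ha'|].
        apply conj_inv_pair; [apply Hg|assumption].
      + intros n. split; eapply cle_weaken; try apply HBn; try apply HBn';
          try (apply ccone_of_cone; assumption); lra.
      + exists (fun n => s (t n)). split; [apply strictly_increasing_comp; assumption|].
        intros b [<-|Hb] m n; [apply Hpe|apply Hconst, Hb]. }
  destruct (Hsub F (incl_refl F)) as (s & Hs & Hconst).
  set (g0 := g (s 0%nat)). set (h0 := h (s 0%nat)).
  destruct (Hg (s 0%nat)) as (Hg0 & Hh0 & [Hgh0 Hhg0] & _). fold g0 h0 in Hg0, Hh0, Hgh0, Hhg0.
  destruct (cle_unit (mv d g0 x0) x0 Hc0 (mv_inRd _ _ _)) as (k1 & Hk1 & Hk1').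
  destruct (cle_unit x0 (mv d g0 x0) (proj2 Hg0 x0 Hc0) (cone_inRd _ _ Hc0)) as (k2 & Hk2 & Hk2').
  (* The mover of index [s 0] serves as reference: [g0 h] takes [x (s n)] to a multiple of [g0 k].
     The radius combines [k <= r0 x0] with [g0 x0 <= k1 x0], and [x0 <= k2 g0 x0] with
     [x0 <= r0 k]. *)
  exists s, (fun n => mmul d g0 (h (s n))), (r0 * k1 * (k2 * r0)).
  split; [assumption|]. split; [repeat apply Rmult_lt_0_compat; assumption|]. intros n.
  destruct (Hg (s n)) as (Hgn & Hhn & [Hghn Hhgn] & HQk & Hxn).
  assert (Hdel : pos L (mmul d g0 (h (s n)))) by (apply subgroup_mul; assumption).
  split.
  - apply HFc; [assumption|]. intros a Ha. destruct (HF a Ha) as (Hpa & _).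
    (* The conjugates of [a] by the movers of index [s n] and [s 0] agree up to [c]; rearranged,
       [g0 h] commutes with [a] up to [c], and a scalar commutator is 1. *)
    destruct (Hconst a Ha n 0%nat) as (c & Hc & Heq).
    assert (E : forall v, inRd d v ->
      mv d (mmul d g0 (h (s n))) (mv d a v) = vscl c (mv d a (mv d (mmul d g0 (h (s n))) v))).
    { intros v Hv. rewrite !mv_mmul. rewrite <- (Hhgn v) at 1 by assumption.
      assert (E1 : mv d (h (s n)) (mv d a (mv d (g (s n)) (mv d (h (s n)) v))) =
                   vscl c (mv d h0 (mv d a (mv d g0 (mv d (h (s n)) v))))).
      { unfold h0, g0. rewrite <- !mv_mmul. rewrite !mv_mmul, <- (mv_mmul d a), <- mv_mmul.
        rewrite <- (mv_mmul d a (g (s 0%nat))), <- (mv_mmul d (h (s 0%nat))).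
        apply mv_proj. exact Heq. }
      rewrite E1, mv_scl, Hhg0 by apply mv_inRd. reflexivity. }
    assert (Hc1 : c = 1) by (apply (scalar_commutator_one _ a c (proj2 Hdel) (proj2 Hpa)); exact E).
    intros v Hv. rewrite E, Hc1 by assumption. vec_eq.
  - destruct (Hgk (s n)) as (t & Ht & Hgt).
    assert (Hx : mv d (mmul d g0 (h (s n))) (x (s n)) = vscl (/ t) (mv d g0 (k (s n)))).
    { replace (x (s n)) with (vscl (/ t) (mv d (g (s n)) (k (s n)))).
      - rewrite mv_mmul, !mv_scl, Hghn by apply Hck. reflexivity.
      - rewrite Hgt. vec_eq. field. lra. }
    assert (Hcg : cone Om (mv d g0 (k (s n)))) by (apply Hg0, Hck).
    rewrite Hx, vnormalize_scl; [|apply Rinv_neq_0_compat; lra|destruct Hcg; lra].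
    destruct (HQb _ HQk) as [Hb1 Hb2].
    apply ball_normalize; try assumption; try (apply Rmult_lt_0_compat; assumption).
    + apply (cle_scl_chain _ (mv d g0 x0)); [lra| |assumption].
      rewrite <- mv_scl. apply cle_mv; [apply Hg0|assumption].
    + apply (cle_scl_chain _ (mv d g0 x0)); [lra|assumption|].
      rewrite <- mv_scl. apply cle_mv; [apply Hg0|assumption].
Qed.

(** [A] is exhausted by the elements which, together with an inverse, displace [x0] by at most
    [n + 1]; by discreteness each stage has finitely many classes. The point [x n] nearly minimizes
    for [F] and for stage [n], with factor [1 + / (INR n + 1)]; the constant 2 bounds all these
    factors. *)
Lemma minimizing_sequence (F : list mat) (x0 : vec) :
  Om x0 -> (forall a, In a F -> pos A a) ->
  exists x : nat -> vec, (forall n, C (x n)) /\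
    (forall n a, In a F -> near_min 2 a (x n)) /\
    (forall a, pos A a -> forall th, 1 < th -> exists N, forall n, (N <= n)%nat ->
       near_min th a (x n)).
Proof.
  intros H0 HF. assert (Hc0 := cone_of_domain x0 H0).
  assert (Hweak : forall th th' a v, th <= th' -> cone Om v -> near_min th a v -> near_min th' a v).
  { intros th th' a v Hth Hv Hm y b Hy Hb H. apply cle_weaken with (th * b).
    - apply Rmult_le_compat_r; lra.
    - apply ccone_of_cone, Hv.
    - apply (Hm y); assumption. }
  set (S := fun (n : nat) a => pos A a /\ cle (mv d a x0) (vscl (INR n + 1) x0) /\
     exists h, pos L h /\ inv_pair d a h /\ cle (mv d h x0) (vscl (INR n + 1) x0)).
  destruct (choice_function nat (list mat) (fun n l => (forall a, In a l -> S n a) /\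
              forall a, S n a -> exists h, In h l /\ proj_eq d a h)) as [l Hl].
  { intros n. apply (finite_classes L (S n) x0 (INR n + 1)); try assumption.
    - pose proof (pos_INR n). lra.
    - intros a (H1 & H2 & H3). split; [apply pos_A_L, H1|]. auto. }
  assert (Hth : forall n, 1 < 1 + / (INR n + 1) <= 2).
  { intros n. pose proof (pos_INR n).
    assert (0 < / (INR n + 1)) by (apply Rinv_0_lt_compat; lra).
    assert (/ (INR n + 1) <= / 1) by (apply Rinv_le_contravar; lra). lra. }
  destruct (choice_function nat vec (fun n x => C x /\
    forall a, In a (F ++ l n) -> near_min (1 + / (INR n + 1)) a x)) as [x Hx].
  { intros n.
    assert (HlA : forall a, In a (F ++ l n) -> pos A a).
    { intros a Ha. apply in_app_or in Ha. destruct Ha as [Ha|Ha]; [auto|].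
      apply (Hl n) in Ha. apply Ha. }
    destruct (simultaneous_near_min C (F ++ l n) (1 + / (INR n + 1))) as (v & Hv & Hm);
      try assumption.
    - apply Hth.
    - intros a Ha. split; [apply HlA, Ha|apply cone_C_map, pos_A_L, HlA, Ha].
    - intros a b Ha Hb. apply proj_commute; [apply HlA, Ha|apply HlA, Hb|].
      apply HAab; apply HlA; assumption.
    - exists (vnormalize v). split; [apply Hv|]. intros a Ha.
      apply near_min_normalize; [|auto]. destruct Hv as (H1 & H2 & H3). repeat split; auto. }
  assert (HxO : forall n, cone Om (x n)) by (intros n; apply cone_of_domain, HCO, Hx).
  exists x. split; [apply Hx|]. split.
  - intros n a Ha. apply (Hweak (1 + / (INR n + 1))); [apply Hth|apply HxO|].
    apply Hx, in_or_app. auto.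
  - intros a Ha th Hth1.
    destruct (pos_inverse A a HA A_aut Ha) as (h & Hh & Hi).
    destruct (cle_unit (mv d a x0) x0 Hc0 (mv_inRd _ _ _)) as (k & Hk & Hax).
    destruct (cle_unit (mv d h x0) x0 Hc0 (mv_inRd _ _ _)) as (k' & Hk' & Hhx).
    destruct (INR_unbounded (k + k')) as [N1 HN1].
    destruct (inv_INR_small (th - 1)) as [N2 HN2]; [lra|].
    exists (N1 + N2)%nat. intros n Hn.
    assert (HnR : k + k' < INR n) by (assert (INR N1 <= INR n) by (apply le_INR; lia); lra).
    assert (HSa : S n a).
    { split; [assumption|]. split.
      - apply cle_weaken with k; [lra|apply ccone_of_cone, Hc0|assumption].
      - exists h. split; [apply pos_A_L, Hh|]. split; [assumption|].
        apply cle_weaken with k'; [lra|apply ccone_of_cone, Hc0|assumption]. }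
    (* Only the representative [b] of the class of [a] is listed; they differ by a positive scalar,
       to which [near_min] is insensitive. *)
    destruct (Hl n) as [Hl1 Hl2]. destruct (Hl2 a HSa) as (b & Hb & Hab).
    destruct (proj_eq_pos a b) as (c & Hc & E); [apply Ha|apply (Hl1 b Hb)|assumption|].
    apply (near_min_proj th c a b); [assumption|assumption|].
    apply (Hweak (1 + / (INR n + 1))); [specialize (HN2 n ltac:(lia)); lra|apply HxO|].
    apply Hx, in_or_app. auto.
Qed.

(** * Existence of minimizers and co-compactness *)

Lemma near_min_displacement_bound (th : R) (a : mat) (x0 : vec) :
  0 < th -> Om x0 -> exists B, 0 < B /\ forall x, near_min th a x -> cle (mv d a x) (vscl B x).
Proof.
  intros Hth H0. apply cone_of_domain in H0.
  destruct (cle_unit (mv d a x0) x0 H0 (mv_inRd _ _ _)) as (k & Hk & Hax).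
  exists (th * k). split; [apply Rmult_lt_0_compat; assumption|].
  intros x Hx. apply (Hx x0); assumption.
Qed.

(** Because the movers commute with all of [A], the moved sequence remains almost minimizing for
    every element of [A], and so its limit in the order ball is minimal for each of them. *)
Lemma minC_nonempty : exists x, MinC d phi Om C A x.
Proof.
  destruct domain_inhabited as [x0 H0].
  destruct central_test_list as (F & HF & HFc).
  destruct (minimizing_sequence F x0 H0) as (x & HxC & HxF & HxA); [intros; apply HF; assumption|].
  destruct (central_return F x0 x HF HFc H0 HxC) as (s & del & r & Hs & Hr & Hdel).
  { intros a Ha. destruct (near_min_displacement_bound 2 a x0) as (B & HB & HBx); [lra|assumption|].
    exists B. split; [assumption|]. intros n. apply HBx, HxF, Ha. }
  set (y := fun n => vnormalize (mv d (del n) (x (s n)))).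
  assert (HyC : forall n, C (y n)).
  { intros n. apply (cone_C_map (del n)); [apply Hdel|]. apply cone_of_set; auto. }
  destruct (ball_subseq x0 r y) as (t & z & Ht & Hz & _ & Hcv); auto.
  { intros n. apply Hdel. }
  exists z. apply minC_iff. split.
  - apply HCclosed; [assumption|]. intros eps He.
    destruct (vcv_close d _ z eps Hcv He) as [N HN]. exists (y (t N)). auto.
  - intros a Ha. apply (near_min_limit a _ z (cone_of_domain z Hz) Hcv). intros th Hth.
    destruct (HxA a Ha th Hth) as [N HN]. exists N. intros n Hn.
    destruct (Hdel (t n)) as [[Hpd Hcd] _].
    assert (Hcx : cone Om (x (s (t n)))) by (apply cone_of_domain; auto).
    apply near_min_normalize; [apply Hpd, Hcx|].
    apply near_min_comm; [apply Hpd|apply Hcx|apply Hcd, Ha|]. apply HN.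
    pose proof (strictly_increasing_ge t n Ht). pose proof (strictly_increasing_ge s (t n) Hs). lia.
Qed.

(** If no radius worked, one could choose [x n] that no central element brings within radius
    [n + 1]; a return to a fixed radius along a subsequence contradicts this. *)
Lemma minC_cobounded (x0 : vec) :
  Om x0 -> exists r, 0 < r /\ forall x, MinC d phi Om C A x ->
    exists g, pcentral g /\ ball x0 r (vnormalize (mv d g x)).
Proof.
  intros H0. destruct central_test_list as (F & HF & HFc).
  apply NNPP. intros Hno.
  assert (Hch : forall n, exists x, MinC d phi Om C A x /\
            forall g, pcentral g -> ~ ball x0 (INR n + 1) (vnormalize (mv d g x))).
  { intros n. apply NNPP. intros Hn. apply Hno. exists (INR n + 1).
    split; [pose proof (pos_INR n); lra|]. intros x Hx. apply NNPP. intros Hx'.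
    apply Hn. exists x. split; [assumption|]. intros g Hg Hb. apply Hx'. exists g. auto. }
  destruct (choice_function _ _ _ Hch) as [x Hx].
  assert (HxM : forall n, C (x n) /\ forall a, pos A a -> near_min 1 a (x n)).
  { intros n. apply minC_iff, Hx. }
  destruct (central_return F x0 x HF HFc H0) as (s & del & r & Hs & Hr & Hdel).
  - intros n. apply HxM.
  - intros a Ha. destruct (near_min_displacement_bound 1 a x0) as (B & HB & HBx); [lra|assumption|].
    exists B. split; [assumption|]. intros n. apply HBx, HxM, HF, Ha.
  - destruct (INR_unbounded r) as [n Hn]. destruct (Hdel n) as [Hc Hb].
    destruct (Hx (s n)) as [_ Hx']. apply (Hx' (del n) Hc).
    apply (ball_weaken x0 _ r); [assumption| | |assumption].
    + apply Hc, cone_of_domain, HCO, HxM.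
    + assert (INR n <= INR (s n)) by (apply le_INR, (strictly_increasing_ge s n Hs)). lra.
Qed.

Lemma minC_cocompact : cocompact d phi (centralizer d L A) (MinC d phi Om C A).
Proof.
  destruct domain_inhabited as [x0 H0].
  destruct (minC_cobounded x0 H0) as (r & Hr & Hret).
  (* The part of the minimal set in an order ball is compact: such a ball is compact inside the
     domain, and both [C] and the exact inequalities are closed there. *)
  exists (fun x => MinC d phi Om C A x /\ ball x0 r x). split; [|split; [|split]].
  - intros u Hu.
    assert (HuM : forall n, C (u n) /\ forall a, pos A a -> near_min 1 a (u n)).
    { intros n. apply minC_iff, Hu. }
    destruct (ball_subseq x0 r u) as (s & z & Hs & Hz & Hzb & Hcv); auto.
    + intros n. apply HCO, HuM.
    + intros n. apply Hu.
    + exists s, z. split; [assumption|]. split; [|assumption]. split; [|assumption].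
      apply minC_iff. split.
      * apply HCclosed; [assumption|]. intros eps He.
        destruct (vcv_close d _ z eps Hcv He) as [N HN]. exists (u (s N)).
        split; [apply HuM|auto].
      * intros a Ha. apply (near_min_limit a _ z (cone_of_domain z Hz) Hcv). intros th Hth.
        exists 0%nat. intros n _ y b Hy Hb H.
        apply cle_weaken with (1 * b); [apply Rmult_le_compat_r; lra| |].
        -- apply ccone_of_cone, cone_of_domain, HCO, HuM.
        -- apply (proj2 (HuM (s n)) a Ha y); assumption.
  - intros x [Hx _]. assumption.
  - intros g k Hg [Hk _]. destruct (centralizer_lift g Hg) as (c & Hc & Hcg).
    assert (HkC : C k) by apply Hk.
    rewrite <- (pact_mscl c), pact_normalize; [|assumption|apply HLaut, Hg|auto].
    apply pcentral_minC; assumption.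
  - intros x Hx. assert (HxC : C x) by apply Hx. destruct (Hret x Hx) as (g & Hg & Hb).
    destruct (pcentral_inverse g Hg) as (h & Hh & [Hi _]).
    exists h, (vnormalize (mv d g x)). split; [apply pcentral_centralizer, Hh|].
    split; [split; [apply pcentral_minC; assumption|assumption]|].
    assert (Hcx := cone_of_domain x (HCO x HxC)).
    assert (Hgx : cone Om (mv d g x)) by (apply Hg, Hcx).
    destruct (domain_chart x (HCO x HxC)) as [_ Hlx].
    rewrite pact_normalize. unfold vnormalize at 2.
    rewrite mv_scl, Hi by apply Hcx.
    rewrite vnormalize_scl; [|apply Rinv_neq_0_compat; destruct Hgx; lra|lra].
    unfold vnormalize. rewrite Hlx. vec_eq. field.
Qed.

Lemma convHull_minC (x : vec) :
  ConvHull d phi Om (MinC d phi Om C A) x <-> MinC d phi Om C A x.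
Proof.
  split.
  - intros H. apply H; [|apply minC_convex|auto]. intros y [Hy _]. apply HCO in Hy.
    split; [apply domain_chart, Hy|]. intros eps He. exists y. split; [assumption|].
    intros i _. rewrite Rminus_diag, Rabs_R0. assumption.
  - intros H S _ _ HS. apply HS, H.
Qed.

End Action.

End Cone.

Theorem mainTheorem2 (d : nat) (phi : vec) (O C : vec -> Prop) (L A : mat -> Prop) :
  naive_ccc d phi O C L ->
  PGL_subgroup d A -> (forall a, A a -> L a) ->
  (forall a b, A a -> A b -> proj_eq d (mmul d a b) (mmul d b a)) ->
  (exists x, MinC d phi O C A x) /\
  cocompact d phi (centralizer d L A) (ConvHull d phi O (MinC d phi O C A)).
Proof.
  intros (Hdom & HL & HLaut & _ & Hdisc & HCne & HCO & HCcl & HCcv & HCinv & HCcc) HA HAL HAab.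
  split; [eapply minC_nonempty with (L := L); eassumption|].
  assert (Hhull : forall x, ConvHull d phi O (MinC d phi O C A) x <-> MinC d phi O C A x).
  { intros x. eapply convHull_minC with (L := L); eassumption. }
  assert (Hco : cocompact d phi (centralizer d L A) (MinC d phi O C A)).
  { eapply minC_cocompact; eassumption. }
  destruct Hco as (K & HK & HKM & Hinv & Hcov). exists K.
  split; [assumption|]. split; [intros x Hx; apply (proj2 (Hhull x)), HKM, Hx|].
  split; [intros g k Hg Hk; apply (proj2 (Hhull _)), Hinv; assumption|].
  intros x Hx. apply Hcov, (proj1 (Hhull x)), Hx.
Qed.
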